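(* Let $\ell\ge 3$ be an integer, let $W$ be the Weyl group of the $\ell$-Kronecker quiver $K_\ell$, let $\widetilde X$ be the universal cover of the space $X\subset\mathfrak h$, let $\widetilde X/\!/W$ be the quotient complex manifold, and let $h=\frac{2\pi\sqrt{-1}}{\log\rho}$ (all defined in the context). There exists a unique Frobenius structure $(\eta,\circ,e,E)$ of rank $2$ and dimension $1-\frac{2}{h}$ on $\widetilde X/\!/W$ such that, for the coordinates $t^1=e^{\frac h2 s^2}s^1$, $t^2=e^{s^2}$, the pair $(t^1,t^2)$ is a system of flat coordinates, $$e=\frac{\partial}{\partial t^1},\qquad E=t^1\frac{\partial}{\partial t^1}+\frac{2}{h}\,t^2\frac{\partial}{\partial t^2},$$ and the intersection form of the Frobenius structure coincides with the bilinear form $g$ on $\Omega^1_{\widetilde X/\!/W}$ induced by the generalized Cartan matrix $A=\begin{pmatrix}2&-\ell\\-\ell&2\end{pmatrix}$ of $K_\ell$.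
   Context: Root data. Let $\ell\ge3$ be an integer. $K_\ell$ is the quiver with vertices $1,2$ and $\ell$ arrows from $1$ to $2$; its generalized Cartan matrix is $A=(a_{ij})=\begin{pmatrix}2&-\ell\\-\ell&2\end{pmatrix}$. Let $L=\mathbb Z\alpha_1\oplus\mathbb Z\alpha_2$ with symmetric bilinear form $I(\alpha_i,\alpha_j)=a_{ij}$, reflections $r_i(\lambda)=\lambda-I(\lambda,\alpha_i)\alpha_i$, and Weyl group $W=\langle r_1,r_2\rangle\subset\mathrm{Aut}(L,I)$. The Coxeter transformation $r_1r_2$ has eigenvalues $\rho^{\pm1}$ with $\rho=\frac{\ell^2-2+\sqrt{\ell^4-4\ell^2}}{2}>1$. Put $\nu=\frac{\ell+\sqrt{\ell^2-4}}2$ (so $\nu^2=\rho$) and $h=\frac{2\pi\sqrt{-1}}{\log\rho}\in\sqrt{-1}\,\mathbb R$ (real logarithm). Let $\mathfrak h=\mathrm{Hom}_{\mathbb Z}(L,\mathbb C)$, $\mathfrak h^*=L\otimes\mathbb C$, $\mathfrak h^*_{\mathbb R}=L\otimes\mathbb R$; $W$ acts linearly on $\mathfrak h^*$ and on $\mathfrak h$ by $\langle w(Z),\lambda\rangle=\langle Z,w^{-1}(\lambda)\rangle$. The space $X$. Let $L_+=\mathbb Z_{\ge0}\alpha_1+\mathbb Z_{\ge0}\alpha_2$, $K=\{\lambda\in L_+\setminus\{0\}: I(\lambda,\alpha_i)\le0,\ i=1,2\}$, $\Delta^{\rm im}_+=W(K)$. Let $\mathcal I\subset\mathfrak h^*_{\mathbb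 R}$ be the closure of the convex hull of $\Delta^{\rm im}_+\cup\{0\}$, and $\mathcal I_0=\mathcal I\setminus\{0\}$. For $\lambda\in\mathfrak h^*$ let $H_\lambda=\{Z\in\mathfrak h: Z(\lambda)=0\}$. Then $X=\mathfrak h\setminus\bigcup_{\lambda\in\mathcal I_0}H_\lambda$. Coordinates. Let $\beta_1=\frac{\nu\alpha_1+\alpha_2}{\sqrt{(\ell^2-4)\nu}}$, $\beta_2=\frac{\alpha_1+\nu\alpha_2}{\sqrt{(\ell^2-4)\nu}}$ in $\mathfrak h^*$, and let $x^i(Z)=Z(\beta_i)$ be the corresponding linear coordinates on $\mathfrak h$. One has $(I(\beta_i,\beta_j))=\begin{pmatrix}0&-1\\-1&0\end{pmatrix}$. The universal cover of $X$ is realized as $\widetilde X=\{(y^1,y^2)\in\mathbb C^2: |\mathrm{Im}(y^1-y^2)|<\pi\}$ with covering map $(y^1,y^2)\mapsto(x^1,x^2)=(e^{y^1},e^{y^2})$. The $W$-action on $X$ is lifted to $\widetilde X$ by $r_1\cdot(y^1,y^2)=(y^2-\log\nu,\,y^1+\log\nu)$, $r_2\cdot(y^1,y^2)=(y^2+\log\nu,\,y^1-\log\nu)$. The space $\widetilde X/\!/W$ is the topological quotient $\widetilde X/W$ with structure sheaf the $W$-invariant holomorphic functions on $\widetilde X$; it is a complex manifold with global coordinates $s^1=e^{\frac h2(y^1-y^2)}-e^{\frac h2(y^2-y^1)}$, $s^2=y^1+y^2$. The functions $t^1=e^{\frac h2 s^2}s^1$, $t^2=e^{s^2}$ form local coordinates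 near every point of $\widetilde X/\!/W$ (locally $t^1=(x^1)^h-(x^2)^h$, $t^2=x^1x^2$). The form $g$. The form $I$ on $\mathfrak h^*\cong T_p^*\mathfrak h$ gives $g:\Omega^1_X\times\Omega^1_X\to\mathcal O_X$ with $g(dx^i,dx^j)=I(\beta_i,\beta_j)$; it is pulled back to $\Omega^1_{\widetilde X}$ and, being $W$-invariant, induces a symmetric $\mathcal O$-bilinear form $g$ on $\Omega^1_{\widetilde X/\!/W}$ (computed on differentials of invariant functions). Frobenius structures. A Frobenius structure of rank $\mu$ and dimension $d\in\mathbb C$ on a connected complex manifold $M$ of dimension $\mu$ is a tuple $(\eta,\circ,e,E)$, with $\eta$ a non-degenerate $\mathcal O_M$-symmetric bilinear form on the holomorphic tangent sheaf $\mathcal T_M$, $\circ$ an $\mathcal O_M$-bilinear associative commutative product on $\mathcal T_M$ with unit $e$, and $E$ a holomorphic vector field, such that: (1) $\eta(\delta\circ\delta',\delta'')=\eta(\delta,\delta'\circ\delta'')$; (2) the Levi-Civita connection $D$ of $\eta$ is flat; (3) the tensor $C$ given by $C_\delta\delta'=\delta\circ\delta'$ satisfies $DC=0$ (i.e. $(D_{\delta}C)_{\delta'}=(D_{\delta'}C)_{\delta}$ for all $\delta,\delta'$, so that locally there is a potential $\mathcal F$ with $\eta(\partial_i\circ\partial_j,\partial_k)=\partial_i\partial_j\partial_k\mathcal F$ in flat coordinates); (4) $De=0$; (5) $\mathrm{Lie}_E(\eta)=(2-d)\eta$ and $\mathrm{Lie}_E(\circ)=\circ$. Flat coordinates are local coordinates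 $(t^1,\dots,t^\mu)$ with $e=\partial/\partial t^1$ and all $\partial/\partial t^i$ being $D$-flat (so the $\eta(\partial_i,\partial_j)$ are constant). The intersection form is the $\mathcal O_M$-bilinear form on $\Omega^1_M$ given in local coordinates $(s^a)$ by $\sum_{a,b}\langle\frac{\partial}{\partial s^a},\omega\rangle\,\eta(ds^a,ds^b)\,\langle E\circ\frac{\partial}{\partial s^b},\omega'\rangle$, where $\eta(ds^a,ds^b)$ denotes the dual form on $\Omega^1_M$. *)

(* Defs.v *)
From HB Require Import structures.
From mathcomp Require Import all_boot all_order all_algebra.
From mathcomp Require Import generic_quotient.
From mathcomp Require Import all_classical all_reals all_analysis.
From mathcomp Require Import complex.
Import Order.TTheory GRing.Theory Num.Theory numFieldNormedType.Exports.

Set Implicit Arguments.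
Unset Strict Implicit.
Unset Printing Implicit Defensive.

Local Open Scope classical_set_scope.
Local Open Scope ring_scope.
Local Open Scope complex_scope.

(* R[i] packaged as a numFieldType, so that [differentiable] and ['D_v f] on  *)
(* it are complex differentiability and complex directional derivatives.      *)
Definition Cx (R : realType) : numFieldType := R[i].

Section Exponential.
Context {R : realType}.

Definition cexp (z : Cx R) : Cx R :=
  (expR (complex.Re z) * cos (complex.Im z))
    +i* (expR (complex.Re z) * sin (complex.Im z)).

Definition row2 (a b : Cx R) : 'rV[Cx R]_2 :=
  \row_(j < 2) (if j == 0 then a else b).

End Exponential.

(* Complex manifolds with global coordinates: M is a space and x : M -> C^n   *)
(* is a homeomorphism onto a connected open subset of C^n.  Tensor fields are *)
(* given by their components in the frame d/dx^a of the tangent sheaf and the *)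
(* frame dx^a of the sheaf of 1-forms.                                        *)
Section GlobalCoordinates.
Context {R : realType} {n : nat} {M : topologicalType}.
Variable x : M -> 'rV[Cx R]_n.

(* f read in the coordinates x; the value at z outside the open set x(M) is   *)
(* the junk value f p and does not affect derivatives at points of x(M).      *)
Definition in_coord (p : M) (f : M -> Cx R) : 'rV[Cx R]_n -> Cx R :=
  fun z => f (xget p [set q | x q = z]).

Definition holomorphic (f : M -> Cx R) : Prop :=
  forall p, differentiable (in_coord p f) (x p).

Definition pderiv (a : 'I_n) (f : M -> Cx R) (p : M) : Cx R :=
  'D_(delta_mx 0 a) (in_coord p f) (x p).

Definition differential (f : M -> Cx R) (p : M) : 'cV[Cx R]_n :=
  \col_a pderiv a f p.

Definition vfield : Type := M -> 'rV[Cx R]_n.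

Definition frame (a : 'I_n) : vfield := fun=> delta_mx 0 a.

Definition vapply (v : vfield) (f : M -> Cx R) (p : M) : Cx R :=
  \sum_a v p 0 a * pderiv a f p.

Definition bracket (v w : vfield) : vfield := fun p =>
  \row_c (vapply v (fun q => w q 0 c) p - vapply w (fun q => v q 0 c) p).

(* Local coordinates near every point: by the inverse function theorem, n     *)
(* holomorphic functions with everywhere linearly independent differentials.  *)
Definition jacobian_matrix (t : M -> 'rV[Cx R]_n) (p : M) : 'M[Cx R]_n :=
  \matrix_(a, i) pderiv a (fun q => t q 0 i) p.

Definition local_coordinates (t : M -> 'rV[Cx R]_n) : Prop :=
  (forall i, holomorphic (fun q => t q 0 i)) /\
  (forall p, jacobian_matrix t p \in unitmx).

(* The vector field d/dt^i, dual to dt^j.                                     *)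
Definition coord_vfield (t : M -> 'rV[Cx R]_n) (i : 'I_n) : vfield :=
  fun p => row i (invmx (jacobian_matrix t p)).

(* Components of a 1-form in the basis dt^i, from those in the basis dx^a.    *)
Definition covector_in (t : M -> 'rV[Cx R]_n) (p : M) (w : 'cV[Cx R]_n) :
  'cV[Cx R]_n := invmx (jacobian_matrix t p) *m w.

Section Metric.
Variable eta : M -> 'M[Cx R]_n.

Definition pairing (v w : vfield) (p : M) : Cx R :=
  (v p *m eta p *m (w p)^T) 0 0.

Definition christoffel (p : M) (a b c : 'I_n) : Cx R :=
  2^-1 * \sum_d invmx (eta p) c d *
    (pderiv a (fun q => eta q b d) p + pderiv b (fun q => eta q a d) p
     - pderiv d (fun q => eta q a b) p).

Definition levi_civita (v w : vfield) : vfield := fun p =>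
  \row_c (vapply v (fun q => w q 0 c) p
          + \sum_a \sum_b v p 0 a * w p 0 b * christoffel p a b c).

Definition curvature (u v w : vfield) : vfield := fun p =>
  levi_civita u (levi_civita v w) p - levi_civita v (levi_civita u w) p
  - levi_civita (bracket u v) w p.

Definition lie_metric (E v w : vfield) (p : M) : Cx R :=
  vapply E (pairing v w) p - pairing (bracket E v) w p
  - pairing v (bracket E w) p.

End Metric.

(* frob_mul p a b is the vector (d/dx^a o d/dx^b)(p).                         *)
Record frobenius_data := FrobeniusData {
  frob_metric : M -> 'M[Cx R]_n;
  frob_mul : M -> 'I_n -> 'I_n -> 'rV[Cx R]_n;
  frob_unit : vfield;
  frob_euler : vfield
}.

Section Frobenius.
Variable S : frobenius_data.
Local Notation eta := (frob_metric S).
Local Notation e := (frob_unit S).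
Local Notation E := (frob_euler S).

Definition frob_prod (p : M) (u v : 'rV[Cx R]_n) : 'rV[Cx R]_n :=
  \sum_a \sum_b (u 0 a * v 0 b) *: frob_mul S p a b.

Definition vprod (v w : vfield) : vfield := fun p => frob_prod p (v p) (w p).

(* (D_u C)_v w, where C_v w = v o w.                                          *)
Definition cov_deriv_mul (u v w : vfield) : vfield := fun p =>
  levi_civita eta u (vprod v w) p - vprod (levi_civita eta u v) w p
  - vprod v (levi_civita eta u w) p.

(* (Lie_E o)(v, w)                                                            *)
Definition lie_mul (v w : vfield) : vfield := fun p =>
  bracket E (vprod v w) p - vprod (bracket E v) w p - vprod v (bracket E w) p.

(* The differential conditions are identities between tensors, hence are      *)
(* expressed on the frame d/dx^a.                                             *)
Record is_frobenius (d : Cx R) : Prop := IsFrobenius {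
  metric_holomorphic : forall a b, holomorphic (fun p => eta p a b);
  mul_holomorphic :
    forall a b c, holomorphic (fun p => frob_mul S p a b 0 c);
  unit_holomorphic : forall a, holomorphic (fun p => e p 0 a);
  euler_holomorphic : forall a, holomorphic (fun p => E p 0 a);
  metric_symmetric : forall p, (eta p)^T = eta p;
  metric_nondegenerate : forall p, eta p \in unitmx;
  mul_commutative : forall p u v, frob_prod p u v = frob_prod p v u;
  mul_associative :
    forall p u v w, frob_prod p (frob_prod p u v) w = frob_prod p u (frob_prod p v w);
  mul_unit : forall p u, frob_prod p (e p) u = u;
  metric_invariant : forall p (u v w : 'rV[Cx R]_n),
    frob_prod p u v *m eta p *m w^T = u *m eta p *m (frob_prod p v w)^T;
  metric_flat : forall a b c p,
    curvature eta (frame a) (frame b) (frame c) p = 0;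
  mul_potential : forall a b c p,
    cov_deriv_mul (frame a) (frame b) (frame c) p =
    cov_deriv_mul (frame b) (frame a) (frame c) p;
  unit_flat : forall a p, levi_civita eta (frame a) e p = 0;
  metric_homogeneous : forall a b p,
    lie_metric eta E (frame a) (frame b) p =
    (2 - d) * pairing eta (frame a) (frame b) p;
  mul_homogeneous : forall a b p,
    lie_mul (frame a) (frame b) p = vprod (frame a) (frame b) p
}.

Definition intersection_form (p : M) (w w' : 'cV[Cx R]_n) : Cx R :=
  \sum_a \sum_b w a 0 * invmx (eta p) a b * (frob_prod p (E p) (frame b p) *m w') 0 0.

End Frobenius.
End GlobalCoordinates.

Definition flat_coordinates {R : realType} {n : nat} {M : topologicalType}
    (x : M -> 'rV[Cx R]_n.+1) (S : @frobenius_data R n.+1 M)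
    (t : M -> 'rV[Cx R]_n.+1) : Prop :=
  [/\ local_coordinates x t,
      frob_unit S = coord_vfield x t 0 &
      forall a i p,
        levi_civita x (frob_metric S) (frame a) (coord_vfield x t i) p = 0].

Section Kronecker.
Context {R : realType}.
Variable l : nat.

Definition cartan : 'M[Cx R]_2 :=
  \matrix_(i < 2, j < 2) (if i == j then 2 else - l%:R).

(* I on h^*, in the basis alpha_1, alpha_2.                                   *)
Definition Iform (u v : 'rV[Cx R]_2) : Cx R := (u *m cartan *m v^T) 0 0.

Definition rho : R := (l%:R ^+ 2 - 2 + Num.sqrt (l%:R ^+ 4 - 4 * l%:R ^+ 2)) / 2.

Definition nu : R := (l%:R + Num.sqrt (l%:R ^+ 2 - 4)) / 2.

Definition hh : Cx R := (2 * pi)%:C * 'i / (ln rho)%:C.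

Definition beta (i : 'I_2) : 'rV[Cx R]_2 :=
  ((Num.sqrt ((l%:R ^+ 2 - 4) * nu))^-1)%:C *:
    (if i == 0 then row2 nu%:C 1 else row2 1 nu%:C).

Definition Xcover : set 'rV[Cx R]_2 :=
  [set y | `|complex.Im (y 0 0 - y 0 1)| < pi].

(* The coordinates x^1, x^2 of the image in X of a point of the cover.        *)
Definition covering (y : Xcover) : 'rV[Cx R]_2 :=
  \row_j cexp (val y 0 j).

(* The form g on the cover, where y^1, y^2 are the global coordinates: w and  *)
(* w' are given in the basis dy^i and g(dx^i, dx^j) = I(beta_i, beta_j).      *)
Definition gform (y : Xcover) (w w' : 'cV[Cx R]_2) : Cx R :=
  let v := covector_in (fun z : Xcover => val z) covering y w in
  let v' := covector_in (fun z : Xcover => val z) covering y w' in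
  \sum_i \sum_j v i 0 * Iform (beta i) (beta j) * v' j 0.

Definition reflection (i : 'I_2) (y : 'rV[Cx R]_2) : 'rV[Cx R]_2 :=
  if i == 0 then row2 (y 0 1 - (ln nu)%:C) (y 0 0 + (ln nu)%:C)
  else row2 (y 0 1 + (ln nu)%:C) (y 0 0 - (ln nu)%:C).

(* W is generated by the involutions r_1, r_2, so its elements act by words   *)
(* in r_1, r_2.                                                               *)
Definition weyl_act (w : seq 'I_2) (y : 'rV[Cx R]_2) : 'rV[Cx R]_2 :=
  foldr reflection y w.

Definition weyl_equiv (y y' : Xcover) : bool :=
  `[< exists w, weyl_act w (val y) = val y' >].

Lemma reflectionK i : involutive (reflection i).
Proof.
move=> y; rewrite /reflection; case: (i == 0);
  by apply/rowP => -[[|[|//]] j2]; rewrite !mxE /= ?addrK ?subrK;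
     congr (y _ _); apply: val_inj.
Qed.

Lemma weyl_equiv_refl : reflexive weyl_equiv.
Proof. by move=> y; apply/asboolP; exists [::]. Qed.

Lemma weyl_equiv_sym : symmetric weyl_equiv.
Proof.
have inv w y : weyl_act (rev w) (weyl_act w y) = y.
  by elim: w => //= i w IH; rewrite rev_cons /weyl_act foldr_rcons reflectionK.
by move=> y y'; apply/asboolP/asboolP => -[w <-]; exists (rev w); rewrite inv.
Qed.

Lemma weyl_equiv_trans : transitive weyl_equiv.
Proof.
move=> y x z /asboolP[w wx] /asboolP[w' wy]; apply/asboolP.
by exists (w' ++ w); rewrite /weyl_act foldr_cat -/(weyl_act w _) wx.
Qed.

Canonical weyl_equiv_rel :=
  EquivRel weyl_equiv weyl_equiv_refl weyl_equiv_sym weyl_equiv_trans.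

Local Open Scope quotient_scope.

Definition orbit_space : topologicalType :=
  quotient_topology {eq_quot weyl_equiv_rel}.

Definition orbit (y : Xcover) : orbit_space := \pi_{eq_quot weyl_equiv_rel} y.

(* The global coordinates s^1, s^2, which are W-invariant functions on the    *)
(* cover, and the local coordinates t^1, t^2.                                 *)
Definition s_cover (y : Xcover) : 'rV[Cx R]_2 :=
  row2 (cexp (hh / 2 * (val y 0 0 - val y 0 1))
        - cexp (hh / 2 * (val y 0 1 - val y 0 0)))
       (val y 0 0 + val y 0 1).

Definition s_coord (p : orbit_space) : 'rV[Cx R]_2 :=
  s_cover (repr (p : {eq_quot weyl_equiv_rel})).

Definition t_coord (p : orbit_space) : 'rV[Cx R]_2 :=
  row2 (cexp (hh / 2 * s_coord p 0 1) * s_coord p 0 0) (cexp (s_coord p 0 1)).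

(* The intersection form is g: both are evaluated on the differentials of     *)
(* functions on the quotient, g after pulling them back to the cover.         *)
Definition intersection_form_is_g (S : @frobenius_data R 2 orbit_space) : Prop :=
  forall f f' : orbit_space -> Cx R,
    holomorphic s_coord f -> holomorphic s_coord f' ->
  forall y : Xcover,
    intersection_form S (orbit y)
      (differential s_coord f (orbit y)) (differential s_coord f' (orbit y)) =
    gform y (differential (fun z : Xcover => val z) (f \o orbit) y)
            (differential (fun z : Xcover => val z) (f' \o orbit) y).

End Kronecker.

Arguments orbit_space R l : clear implicits.
Arguments hh R l : clear implicits.
Arguments t_coord {R} l p.
Arguments s_coord {R} l p.

(* Main.v *)
(* In the global coordinates s^1, s^2 everything is explicit.  Writing        *)
(* q = exp(h s^2 / 2), one finds d/dt^1 = q^-1 d/ds^1 and E = (2/h) d/ds^2,   *)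
(* and the functions f on the quotient satisfy                                *)
(*   g(df, df') = (h^2/2 ((s^1)^2 + 4) f_1 f'_1 - 2 f_2 f'_2) exp(- s^2).     *)
(* Flatness of d/dt^1 and d/dt^2 determines the Christoffel symbols of eta,   *)
(* hence the derivatives of eta; with the homogeneity of eta and 2/h <> 1     *)
(* this leaves eta unknown only up to the factor eta(d/ds^1, d/ds^2), and the *)
(* equality of the intersection form with g then fixes this factor and the    *)
(* product d/ds^2 o d/ds^2, the other products being given by the unit.  The  *)
(* structure found in this way satisfies all the axioms by computation.       *)
(*   All derivatives are taken in the chart s, so one needs that s is         *)
(* injective on orbits and that its image is open in C^2.                     *)
From HB Require Import structures.
Require Import Defs.
From mathcomp Require Import all_boot all_order all_algebra.
From mathcomp Require Import generic_quotient.
From mathcomp Require Import all_classical all_reals all_analysis.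
From mathcomp Require Import complex.
From mathcomp Require Import ring lra.
Import Order.TTheory GRing.Theory Num.Theory numFieldNormedType.Exports.

Set Implicit Arguments.
Unset Strict Implicit.
Unset Printing Implicit Defensive.

Local Open Scope classical_set_scope.
Local Open Scope ring_scope.
Local Open Scope complex_scope.

(** * Complex calculus in global coordinates *)

(** In the flat coordinates the structure is elementary. Put $P=e^{h(y^1-y^2)/2}$, so that
    $s^1=P-1/P$, and read $(t^2)^c$ as $e^{cs^2}$. Then $g(dt^1,dt^1)=2h^2(t^2)^{h-1}$,
    $g(dt^1,dt^2)=-ht^1$ and $g(dt^2,dt^2)=-2t^2$. The structure has
    $\eta(\partial_1,\partial_2)=-1/h$, $\eta(\partial_i,\partial_i)=0$, unit $\partial_1$ and
    $\partial_2\circ\partial_2=-h^2(t^2)^{h-2}\partial_1$, with potential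
    $-\frac{(t^1)^2t^2}{2h}+\frac{(t^2)^{h+1}}{h^2-1}$. Since $t$ is only a local coordinate system,
    all of this is transported to the frame of the global chart $s$, where every component is a
    polynomial in $s^1$ times an exponential of $s^2$ ([quad_exp_calc]); the axioms become
    identities between such functions ([is_frobenius_s]).

    Two geometric facts support the computation. First, $h\log\nu=\pi i$, so each reflection sends
    $P$ to $-1/P$, and the fibres of $s$ are exactly the $W$-orbits ([s_coord_inj]); the image of
    $s$ is the product of the interior of an ellipse with $\mathbb C$, hence open ([s_image],
    [s_coord_open]). Second, the $\beta_i$ are isotropic, which gives $g$ in the frame $ds^a$
    ([gform_orbit]).

    For uniqueness, flatness of the $\partial/\partial t^i$ forces the connection
    ([christoffel_unique]). Metric compatibility together with homogeneity leaves one unknown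
    function in $\eta$, because $h$ is imaginary and so differs from $2$ ([metric_components]). The
    unit gives all products but one ([mul_unique_0], [mul_unique_10]). The value of $g$ on
    $(ds^2,ds^2)$ then fixes the scale of $\eta$, and its other values fix the last product
    ([frobenius_unique]). *)

Lemma near_eq_differentiable (K : numFieldType) (V W : normedModType K)
    (f g : V -> W) (a : V) :
  (\forall z \near a, f z = g z) -> differentiable f a -> differentiable g a.
Proof.
move=> fg /diffP[dfc dfo]; apply/diffP.
(* The differential of [g] is a chosen linear map, so it is enough to exhibit one with the required
   expansion. That of [f] works, the remainder being a local condition. *)
apply: (@getPex _ (fun dg : {linear V -> W} => continuous dg /\
  forall y, g y = g (lim (nbhs a)) + dg (y - lim (nbhs a))
                  +o_(y \near a) (y - lim (nbhs a)))).
exists ('d f a); split=> //.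
have lim_a : lim (nbhs a) = a by rewrite lim_id.
have {}dfo : f = (fun y => f a + 'd f a (y - lim (nbhs a)))
    +o_a (fun y => y - lim (nbhs a)).
  by apply: eqaddoE; apply/funext => y; rewrite [LHS]dfo lim_a.
apply: eqaddoEx => y; move: y; apply/funeqP; apply/eqaddoP.
move/eqaddoP: dfo => dfo e e0; move: (dfo e e0); apply: filter_app.
apply: filterS (fg) => y fgy; rewrite !fctE lim_a /= fgy.
by rewrite (_ : g a = f a) //; apply/esym/(nbhs_singleton fg).
Qed.

Lemma diff_coord (K : numFieldType) m n (i : 'I_m) (j : 'I_n) (A v : 'M[K]_(m, n)) :
  'd (fun B : 'M[K]_(m, n) => B i j : K) A v = v i j.
Proof.
have lin : linear (fun B : 'M[K]_(m, n) => B i j : K).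
  by move=> k B C; rewrite !mxE.
pose f : {linear 'M[K]_(m, n) -> K} :=
  HB.pack (fun B : 'M[K]_(m, n) => B i j : K) (GRing.isLinear.Build _ _ _ _ _ lin).
by rewrite -[fun B => _]/(f : _ -> _) diff_lin //; exact: coord_continuous.
Qed.

Lemma differentiable_rV (K : numFieldType) (V : normedModType K) n
    (f : V -> 'rV[K]_n) (a : V) :
  (forall i, differentiable (fun z => f z 0 i : K) a) -> differentiable f a.
Proof.
move=> df.
have -> : f = \sum_(i < n) (fun z => f z 0 i *: (delta_mx 0 i : 'rV[K]_n)).
  by apply/funext => z; rewrite fct_sumE [LHS]row_sum_delta.
by apply: differentiable_sum => i; exact: differentiableZl.
Qed.

Lemma diff_rV (K : numFieldType) (V : normedModType K) n
    (f : V -> 'rV[K]_n) (a v : V) i :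
  differentiable f a -> 'd f a v 0 i = 'd (fun z => f z 0 i : K) a v.
Proof.
move=> df; rewrite -[fun z => _]/((fun B : 'rV[K]_n => B 0 i : K) \o f).
have /(_ (differentiable_coord (f a) 0 i)) E :=
  @diff_comp K V 'rV[K]_n K f (fun B => B 0 i : K) a df.
by rewrite E /= diff_coord.
Qed.

Section ChartCalculus.
Context {R : realType} {n : nat} {M : topologicalType}.
Variable x : M -> 'rV[Cx R]_n.
Hypothesis x_inj : injective x.

Lemma in_coordE p q f : in_coord x p f (x q) = f q.
Proof.
rewrite /in_coord; case: xgetP => [y _ /x_inj -> //|/(_ q)].
by move=> /(_ erefl).
Qed.

Lemma holomorphic_cst c : holomorphic x (fun=> c).
Proof. by move=> p; exact: differentiable_cst. Qed.

Lemma holomorphicD f g : holomorphic x f -> holomorphic x g ->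
  holomorphic x (fun p => f p + g p).
Proof. by move=> hf hg p; apply: (differentiableD (hf p) (hg p)). Qed.

Lemma holomorphicN f : holomorphic x f -> holomorphic x (fun p => - f p).
Proof. by move=> hf p; apply: (differentiableN (hf p)). Qed.

Lemma holomorphicM f g : holomorphic x f -> holomorphic x g ->
  holomorphic x (fun p => f p * g p).
Proof. by move=> hf hg p; apply: (differentiableM (hf p) (hg p)). Qed.

Lemma pderiv_cst a c p : pderiv x a (fun=> c) p = 0.
Proof. exact: derive_cst. Qed.

Lemma pderivD a f g p : holomorphic x f -> holomorphic x g ->
  pderiv x a (fun q => f q + g q) p = pderiv x a f p + pderiv x a g p.
Proof.
move=> hf hg; apply: (deriveD (diff_derivable (hf p)) (diff_derivable (hg p))).
Qed.

Lemma pderivN a f p : holomorphic x f ->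
  pderiv x a (fun q => - f q) p = - pderiv x a f p.
Proof. move=> hf; apply: (deriveN (diff_derivable (hf p))). Qed.

Lemma pderivM a f g p : holomorphic x f -> holomorphic x g ->
  pderiv x a (fun q => f q * g q) p = f p * pderiv x a g p + g p * pderiv x a f p.
Proof.
move=> hf hg.
have := deriveM (diff_derivable (hf p) : derivable _ _ (delta_mx 0 a))
  (diff_derivable (hg p)).
by rewrite !in_coordE.
Qed.

Lemma holomorphic_comp1 (g : Cx R -> Cx R) f : holomorphic x f ->
  (forall z : Cx R, derivable g z (1 : Cx R)) -> holomorphic x (fun p => g (f p)).
Proof.
move=> hf hg p; apply: (differentiable_comp (hf p)).
exact/derivable1_diffP.
Qed.

Lemma pderiv_comp1 (g g' : Cx R -> Cx R) f a p : holomorphic x f ->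
  (forall z : Cx R, is_derive z (1 : Cx R) g (g' z)) ->
  pderiv x a (fun q => g (f q)) p = g' (f p) * pderiv x a f p.
Proof.
move=> hf hg.
have dg z : differentiable g z by apply/derivable1_diffP; case: (hg z).
rewrite /pderiv -[in_coord x p (fun q => g (f q))]/(g \o in_coord x p f).
rewrite deriveE; last exact: differentiable_comp.
rewrite diff_comp //= deriveE //.
rewrite in_coordE.
(* In one variable a differential is multiplication by its value at 1. *)
have -> : 'd (in_coord x p f) (x p) (delta_mx 0 a) =
    'd (in_coord x p f) (x p) (delta_mx 0 a) *: (1 : Cx R).
  by rewrite /GRing.scale/= mulr1.
rewrite linearZ /= -deriveE //.
have -> : 'd g (f p) 1 = g' (f p) by rewrite -deriveE //; case: (hg (f p)).
by rewrite /GRing.scale/= mulr1 mulrC.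
Qed.

Hypothesis x_open : forall p, \forall z \near x p, exists q, x q = z.

(** Openness of the image makes the junk value of [in_coord] harmless: every point near [x p] is the
    coordinate vector of some point of [M]. *)
Lemma in_coord_coord p a :
  \forall z \near x p, in_coord x p (fun q => x q 0 a) z = z 0 a.
Proof.
near=> z; have [q <-] : exists q, x q = z by near: z; exact: x_open.
by rewrite in_coordE.
Unshelve. all: by end_near. Qed.

Lemma holomorphic_coord a : holomorphic x (fun q => x q 0 a).
Proof.
move=> p.
apply: (@near_eq_differentiable _ _ _ (fun z : 'rV[Cx R]_n => z 0 a : Cx R)).
  by apply: filterS (in_coord_coord p a) => z ->.
exact: differentiable_coord.
Qed.

Lemma pderiv_coord a b p : pderiv x a (fun q => x q 0 b) p = (a == b)%:R.
Proof.
rewrite /pderiv (near_eq_derive _ (in_coord_coord p b)).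
rewrite deriveE; last exact: differentiable_coord.
by rewrite diff_coord mxE eqxx eq_sym.
Qed.

End ChartCalculus.

(** * Chain rule between two charts *)

Section ChartChain.
Context {R : realType} {n m : nat} {M N : topologicalType}.
Variables (x : M -> 'rV[Cx R]_n) (y : N -> 'rV[Cx R]_m).
Hypothesis x_inj : injective x.
Variable phi : N -> M.
Hypothesis phi_hol : forall a, holomorphic y (fun q => x (phi q) 0 a).

(** The map [phi] seen through both charts. Off the image of [y] it takes the value at [q], the same
    convention as [in_coord], so the factorization [in_coord_chain] holds at every [z]. *)
Let read q z : 'rV[Cx R]_n := x (phi (xget q [set q' | y q' = z])).

Let read_diff q : differentiable (read q) (y q).
Proof. by apply: differentiable_rV => a; exact: phi_hol. Qed.

Hypothesis y_inj : injective y.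

Let readE q : read q (y q) = x (phi q).
Proof.
apply/rowP => a.
by rewrite -[LHS]/(in_coord y q (fun q' => x (phi q') 0 a) (y q)) in_coordE.
Qed.

Let in_coord_chain f q :
  in_coord y q (f \o phi) = in_coord x (phi q) f \o read q.
Proof. by apply/funext => z /=; rewrite in_coordE. Qed.

Lemma pderiv_chain f i q : holomorphic x f ->
  pderiv y i (f \o phi) q =
  \sum_a pderiv x a f (phi q) * pderiv y i (fun q' => x (phi q') 0 a) q.
Proof.
move=> hf; have df := hf (phi q); rewrite -readE in df.
rewrite /pderiv in_coord_chain deriveE; last exact: differentiable_comp.
rewrite diff_comp //= [X in 'd _ _ X]row_sum_delta linear_sum.
apply: eq_bigr => a _; rewrite linearZ /= diff_rV //.
rewrite -(deriveE _ (phi_hol a q)) readE -(deriveE _ (hf (phi q))).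
exact: mulrC.
Qed.

End ChartChain.

(** * The complex exponential *)

Section ComplexExponential.
Context {R : realType}.
Implicit Types z w : Cx R.

Lemma cexpD z w : cexp (z + w) = cexp z * cexp w.
Proof.
case: z w => [a b] [c d]; apply/eqP; rewrite eq_complex /cexp /= expRD cosD sinD.
by apply/andP; split; apply/eqP; ring.
Qed.

Lemma cexp0 : cexp (0 : Cx R) = 1.
Proof. by rewrite /cexp /= cos0 sin0 expR0 mulr1 mulr0. Qed.

Lemma cexp_neq0 z : cexp z != 0.
Proof.
apply/eqP => z0; have := cexpD z (- z); rewrite subrr cexp0 z0 mul0r.
by move/eqP; rewrite oner_eq0.
Qed.

Lemma cexpN z : cexp (- z) = (cexp z)^-1.
Proof.
by apply: (mulfI (cexp_neq0 z)); rewrite -cexpD subrr cexp0 divff ?cexp_neq0.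
Qed.

Lemma norm_cexp z : `|cexp z| = (expR (complex.Re z))%:C.
Proof.
rewrite normc_def /=; congr (_%:C).
rewrite !exprMn -mulrDr cos2Dsin2 mulr1 sqrtr_sqr ger0_norm //; exact: expR_ge0.
Qed.

Lemma cexp_surj w : w != 0 -> exists z, cexp z = w.
Proof.
case: w => a b w0; set m := Num.sqrt (a ^+ 2 + b ^+ 2).
have m2 : 0 < a ^+ 2 + b ^+ 2.
  rewrite lt0r addr_ge0 ?sqr_ge0 // andbT paddr_eq0 ?sqr_ge0 // !sqrf_eq0.
  by move: w0; rewrite eq_complex.
have m0 : 0 < m by rewrite sqrtr_gt0.
have mE : m ^+ 2 = a ^+ 2 + b ^+ 2 by rewrite sqr_sqrtr // ltW.
have am : -1 <= a / m <= 1.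
  rewrite -ler_norml (normrM a) normfV (gtr0_norm m0) ler_pdivrMr // mul1r.
  by rewrite -sqrtr_sqr ler_wsqrtr // lerDl sqr_ge0.
have sinE : sin (acos (a / m)) = `|b| / m.
  have -> : `|b| / m = `|b / m| by rewrite normf_div (gtr0_norm m0).
  rewrite sin_acos // -sqrtr_sqr; congr Num.sqrt.
  rewrite !exprMn !exprVn mE; field; exact: lt0r_neq0.
(* The arccosine has non-negative sine, so the sign of the argument is that of [b]. *)
pose t := if 0 <= b then acos (a / m) else - acos (a / m).
have cost : cos t = a / m by rewrite /t; case: ifP => _; rewrite ?cosN acosK.
have sint : sin t = b / m.
  rewrite /t; case: (lerP 0 b) => b0; rewrite ?sinN sinE.
    by rewrite ger0_norm.
  by rewrite ltr0_norm // mulNr opprK.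
exists (ln m +i* t); rewrite /cexp /= lnK ?posrE // cost sint.
by rewrite ![m * _]mulrC !divfK // lt0r_neq0.
Qed.

(** Reduce modulo $2\pi$ to $c\in[0,2\pi)$ and use $\cos c=1-2\sin^2(c/2)$, where $\sin(c/2)>0$
    unless $c=0$. *)
Lemma cos_eq1 (b : R) : cos b = 1 -> exists k : int, b = 2 * pi * k%:~R.
Proof.
move=> cosb; have pi2 : 0 < 2 * pi :> R by rewrite mulr_gt0 ?pi_gt0.
pose k := Num.floor (b / (2 * pi)); exists k; pose c := b - 2 * pi * k%:~R.
have kb : k%:~R <= b / (2 * pi) < (k + 1)%:~R.
  exact: floor_itv.
have [c0 c1] : 0 <= c /\ c < 2 * pi.
  case/andP: kb; rewrite ler_pdivlMr // ltr_pdivrMr // rmorphD /= mulrDl mul1r.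
  by rewrite /c => h1 h2; split; lra.
suff : c = 0 by rewrite /c; lra.
have cosc : cos c = 1.
  rewrite -cosb /c; case: (k) => n; last first.
    rewrite NegzE mulrNz mulrN opprK -[RHS](periodicn (@cosD2pi R) n.+1).
    by congr cos; rewrite -pmulrn -[_ *+ n.+1]mulr_natr; ring.
  rewrite -[LHS](periodicn (@cosD2pi R) n).
  by congr cos; rewrite -pmulrn -[_ *+ n]mulr_natr; ring.
apply/eqP; rewrite eq_le c0 andbT leNgt; apply/negP => cgt0.
have : 0 < sin (c / 2) by apply: sin_gt0_pi; lra.
have : cos c = 1 - 2 * sin (c / 2) ^+ 2.
  by rewrite -[in LHS](_ : (c / 2) *+ 2 = c) ?cos_mulr2n ?cos2sin2; lra.
rewrite cosc => /eqP; nra.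
Qed.

Lemma cexp_eq1 z : cexp z = 1 -> exists k : int, z = (2 * pi)%:C * 'i *~ k.
Proof.
move=> z1; have := norm_cexp z; rewrite z1 normr1 => /complexI.
case: z z1 => a b [] + _ /= => + ea1; rewrite -ea1 mul1r => /cos_eq1[k ->].
exists k; rewrite -[RHS]mulrzr.
have -> : a = 0 by apply: expR_inj; rewrite expR0.
have -> : (k%:~R : Cx R) = (k%:~R)%:C by rewrite rmorph_int.
by apply/eqP; rewrite eq_complex /=; apply/andP; split; apply/eqP; ring.
Qed.

Lemma normc_i : `|'i%C : Cx R| = 1.
Proof. by rewrite normc_def /= expr0n add0r expr1n sqrtr1. Qed.

Lemma normc_le_ReIm z :
  `|z| <= (`|complex.Re z| + `|complex.Im z|)%:C.
Proof.
have normR (a : R) : `|a%:C| = `|a|%:C :> R[i].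
  by rewrite normc_def /= expr0n addr0 sqrtr_sqr.
rewrite [X in `|X|]complexE (le_trans (ler_normD _ _)) // normrM !normR.
by rewrite normc_i mul1r rmorphD.
Qed.

Lemma normc_ge_Im z : `|complex.Im z|%:C <= `|z|.
Proof.
rewrite -[`|complex.Im z|]normrN -ReiNIm (le_trans (normc_ge_Re _)) // normrM.
by rewrite normc_i mulr1.
Qed.

Lemma is_derive_near0 (f : R -> R) (df e : R) :
  is_derive (0 : R) (1 : R) f df -> 0 < e ->
  \forall t \near (0 : R), `|f t - f 0 - df * t| <= e * `|t|.
Proof.
case=> fd fdE e0; have : f \o shift 0 = cst (f 0) + 'd f 0 +o_ (0 : R) id.
  by apply: diff_locally; apply/derivable1_diffP.
move/eqaddoP => /(_ e e0); apply: filterS => t /=.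
rewrite /shift /= !fctE addr0 opprD addrA.
have -> : 'd f 0 t = df * t; last by [].
rewrite -[in 'd f 0 t](mulr1 t) -[t * 1]/(t *: 1) linearZ -deriveE ?fdE.
  exact: mulrC.
exact/derivable1_diffP.
Qed.

Lemma nbhs0_Re (P : R -> Prop) : (\forall t \near (0 : R), P t) ->
  \forall z \near (0 : Cx R), P (complex.Re z).
Proof.
case/nbhs_ballP => d /= d0 dP; apply/nbhs_ballP; exists d%:C => /=.
  by rewrite ltcR.
move=> z; rewrite /ball /= sub0r normrN => zd; apply: dP.
rewrite /ball /= sub0r normrN -ltcR.
exact: le_lt_trans (normc_ge_Re z) zd.
Qed.

Lemma nbhs0_Im (P : R -> Prop) : (\forall t \near (0 : R), P t) ->
  \forall z \near (0 : Cx R), P (complex.Im z).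
Proof.
case/nbhs_ballP => d /= d0 dP; apply/nbhs_ballP; exists d%:C => /=.
  by rewrite ltcR.
move=> z; rewrite /ball /= sub0r normrN => zd; apply: dP.
rewrite /ball /= sub0r normrN -ltcR.
exact: le_lt_trans (normc_ge_Im z) zd.
Qed.

(** Complex differentiability of the exponential at 0, obtained from the real derivatives of exp,
    cos and sin at 0. *)
Lemma cexp_near0 (e : R) : 0 < e ->
  \forall z \near (0 : Cx R), `|cexp z - 1 - z| <= e%:C * `|z|.
Proof.
(* With $z=a+ib$, the estimates below bound the error by $d|a|+5d|b|$, whence $d=e/6$. *)
move=> e0; have [d d0 eE] : exists2 d, 0 < d & e = d + 5 * d.
  by exists (e / 6); [rewrite divr_gt0 | field].
have expA := nbhs0_Re (is_derive_near0 (is_derive_expR 0) d0).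
have cosB := nbhs0_Im (is_derive_near0 (is_derive_cos 0) d0).
have sinB := nbhs0_Im (is_derive_near0 (is_derive_sin 0) d0).
have expC c : 0 < c -> \forall z \near (0 : Cx R), `|expR (complex.Re z) - 1| <= c.
  move=> c0; apply: (@nbhs0_Re (fun t => `|expR t - 1| <= c)); rewrite -[1]expR0.
  have /cvgrPdist_le /(_ c c0) := @continuous_expR R 0.
  by apply: filterS => t; rewrite distrC.
have exp1 := expC 1 ltr01; have exp2 := expC d d0.
apply: filterS (filterI expA (filterI cosB (filterI sinB (filterI exp1 exp2)))).
case=> a b [/= + [+ [+ [h1 h2]]]].
rewrite expR0 cos0 sin0 oppr0 mul0r !mul1r !subr0 ?addr0 => hA hB hS.
apply: le_trans (normc_le_ReIm _) _; rewrite /cexp /= !subr0.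
apply: (@le_trans _ _ (d * `|a| + 5 * d * `|b|)%:C).
  rewrite lecR.
  have -> : expR a * cos b - 1 - a = expR a * (cos b - 1) + (expR a - 1 - a) by ring.
  have -> : expR a * sin b - b = expR a * (sin b - b) + (expR a - 1) * b by ring.
  have ha : `|expR a| <= 2.
    have -> : expR a = (expR a - 1) + 1 by ring.
    by rewrite (le_trans (ler_normD _ _)) // normr1; lra.
  have := ler_normD (expR a * (cos b - 1)) (expR a - 1 - a).
  have := ler_normD (expR a * (sin b - b)) ((expR a - 1) * b).
  rewrite !normrM.
  have := ler_pM (normr_ge0 _) (normr_ge0 _) ha hB.
  have := ler_pM (normr_ge0 _) (normr_ge0 _) ha hS.
  have := ler_wpM2r (normr_ge0 b) h2.
  lra.
have -> : e%:C = d%:C + 5%:R * d%:C.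
  by rewrite -[5%:R](rmorph_nat (real_complex R)) -rmorphM -rmorphD eE.
have dC : 0 <= d%:C by rewrite ler0c ltW.
rewrite rmorphD !rmorphM rmorph_nat [leRHS]mulrDl lerD //=.
  exact: ler_wpM2l (normc_ge_Re (a +i* b)).
rewrite -!mulrA ler_wpM2l ?ler0n //.
exact: ler_wpM2l (normc_ge_Im (a +i* b)).
Qed.

(** The functional equation $e^{z+h}=e^ze^h$ moves the expansion at 0 to [z]. *)
Lemma is_derive_cexp z : is_derive z (1 : Cx R) cexp (cexp z).
Proof.
suff cvg_cexp : h^-1 *: (cexp (h *: (1 : Cx R) + z) - cexp z) @[h --> 0^']
    --> cexp z.
  by apply: DeriveDef; [apply/cvg_ex; exists (cexp z) | exact: cvg_lim].
have cz0 : 0 < `|cexp z| by rewrite normr_gt0 cexp_neq0.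
apply/cvgrPdist_le => /= e e0; pose d := complex.Re (e / `|cexp z|).
have dE : d%:C = e / `|cexp z| by rewrite RRe_real // gtr0_real // divr_gt0.
have d0 : 0 < d by rewrite -ltcR dE divr_gt0.
have near1 : \forall h \near (0 : Cx R)^', `|cexp h - 1 - h| <= d%:C * `|h|.
  exact: cvg_within (cexp_near0 d0).
near=> h; have h0 : h != 0 by near: h; exact: (nbhs_dnbhs_neq (0 : Cx R)).
rewrite -[h *: 1]/(h * 1) mulr1 cexpD.
have -> : cexp z - h^-1 *: (cexp h * cexp z - cexp z) =
    - (cexp z / h * (cexp h - 1 - h)).
  by rewrite -[_ *: _]/(_ * _); field.
rewrite normrN normrM normf_div -ler_pdivlMl; last by rewrite divr_gt0 // normr_gt0.
apply: (@le_trans _ _ (d%:C * `|h|)); first by near: h.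
by rewrite dE invf_div [leLHS]mulrC [e / _]mulrC mulrA.
Unshelve. all: by end_near. Qed.

End ComplexExponential.

(** * The chart s on the orbit space *)

Section OrbitSpaceChart.
Context {R : realType}.
Variable l : nat.
Hypothesis l_ge3 : (3 <= l)%N.
Local Notation h := (hh R l).
Local Notation nu := (nu l : R).

Let l3 : 3 <= l%:R :> R.
Proof. by rewrite (ler_nat R 3). Qed.

Lemma nu_quadratic : nu ^+ 2 - l%:R * nu + 1 = 0.
Proof.
have D0 : 0 <= l%:R ^+ 2 - 4 :> R by have := l3; nra.
have := sqr_sqrtr D0; rewrite /Defs.nu; nra.
Qed.

Lemma nu_gt1 : 1 < nu.
Proof.
have := sqrtr_ge0 (l%:R ^+ 2 - 4 : R); rewrite /Defs.nu; have := l3; lra.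
Qed.

Lemma rho_nu : rho l = nu ^+ 2.
Proof.
have D0 : 0 <= l%:R ^+ 2 - 4 :> R by have := l3; nra.
rewrite /rho (_ : l%:R ^+ 4 - _ = l%:R ^+ 2 * (l%:R ^+ 2 - 4)); last by ring.
rewrite sqrtrM ?sqr_ge0 // sqrtr_sqr ger0_norm ?ler0n //.
by have := sqr_sqrtr D0; rewrite /Defs.nu; nra.
Qed.

Lemma ln_nu_gt0 : 0 < ln nu.
Proof. by rewrite ln_gt0 // nu_gt1. Qed.

Lemma hhE : h = 0 +i* (pi / ln nu).
Proof.
rewrite /hh rho_nu lnXn ?(lt_trans ltr01 nu_gt1) //.
have := lt0r_neq0 ln_nu_gt0 => L0.
rewrite -fmorphV [LHS]mulrAC -rmorphM; apply/eqP; rewrite eq_complex /=.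
apply/andP; split; apply/eqP; first by ring.
by rewrite -[ln nu *+ 2]mulr_natr; field; rewrite ?L0.
Qed.

Lemma hh_neq0 : h != 0.
Proof.
rewrite hhE eq_complex /= eqxx /= mulf_neq0 ?invr_neq0 //.
  exact: lt0r_neq0 (pi_gt0 R).
exact: lt0r_neq0 ln_nu_gt0.
Qed.

(** $h$ is purely imaginary. With $a=2$ this gives $1-2/h\ne0$, on which the uniqueness of the
    metric rests. *)
Lemma hh_neq_real (a : R) : a != 0 -> h != a%:C.
Proof. by rewrite hhE eq_complex /= eq_sym => /negPf ->. Qed.

Lemma hh_ln_nu : h * (ln nu)%:C = 0 +i* pi.
Proof.
have L0 := lt0r_neq0 ln_nu_gt0.
rewrite hhE; apply/eqP; rewrite eq_complex /=.
by apply/andP; split; apply/eqP; [ring | field].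
Qed.

Lemma cexp_hh_nu : cexp (h * (ln nu)%:C) = -1.
Proof.
rewrite hh_ln_nu /cexp /= expR0 cospi sinpi mul1r mulr0.
by apply/eqP; rewrite eq_complex /= oppr0 !eqxx.
Qed.

Definition phase (y : 'rV[Cx R]_2) : Cx R := cexp (h / 2 * (y 0 0 - y 0 1)).

Definition s_fun (y : 'rV[Cx R]_2) : 'rV[Cx R]_2 :=
  row2 (phase y - (phase y)^-1) (y 0 0 + y 0 1).

Lemma s_coverE (y : Xcover) : s_cover l y = s_fun (val y).
Proof.
rewrite /s_cover /s_fun /phase; congr (row2 (_ - _) _).
by rewrite -cexpN -mulrN opprB.
Qed.

Lemma row2_inj (a b c d : Cx R) : row2 a b = row2 c d -> a = c /\ b = d.
Proof.
move=> E; split.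
  by have := congr1 (fun v : 'rV__ => v 0 0) E; rewrite !mxE.
by have := congr1 (fun v : 'rV__ => v 0 1) E; rewrite !mxE.
Qed.

Lemma row2P (u v : 'rV[Cx R]_2) : u 0 0 = v 0 0 -> u 0 1 = v 0 1 -> u = v.
Proof.
move=> e0 e1; apply/rowP => -[[|[|//]] j2].
  by rewrite (_ : Ordinal j2 = 0) //; apply: val_inj.
by rewrite (_ : Ordinal j2 = 1) //; apply: val_inj.
Qed.

Lemma row2_0 (a b : Cx R) : row2 a b 0 0 = a.
Proof. by rewrite mxE. Qed.

Lemma row2_1 (a b : Cx R) : row2 a b 0 1 = b.
Proof. by rewrite mxE. Qed.

(** A reflection sends $y^1-y^2$ to its opposite shifted by $\mp2\log\nu$, and the shift contributes
    $e^{\mp h\log\nu}=-1$. *)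
Lemma phase_reflection i y : phase (reflection l i y) = - (phase y)^-1.
Proof.
rewrite /phase /reflection; case: ifP => _; rewrite !row2_0 !row2_1.
  rewrite (_ : h / 2 * _ = - (h / 2 * (y 0 0 - y 0 1)) - h * (ln nu)%:C); last by field.
  by rewrite cexpD !cexpN cexp_hh_nu invrN1 mulrN1.
rewrite (_ : h / 2 * _ = - (h / 2 * (y 0 0 - y 0 1)) + h * (ln nu)%:C); last by field.
by rewrite cexpD !cexpN cexp_hh_nu mulrN1.
Qed.

Lemma s_fun_weyl w y : s_fun (weyl_act l w y) = s_fun y.
Proof.
elim: w => //= i w <-; rewrite -/(weyl_act l w y); move: (weyl_act _ _ _) => {}y.
rewrite /s_fun phase_reflection; congr row2.
  by rewrite invrN invrK opprK addrC.
by rewrite /reflection; case: ifP => _; rewrite row2_0 row2_1; ring.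
Qed.

(** The product of the two reflections, in either order, is a translation along $(1,-1)$ by
    $\pm2\log\nu$; these words are iterated. *)
Lemma weyl_translation (k : int) y :
  exists w, weyl_act l w y =
    row2 (y 0 0 + 2 * (ln nu)%:C *~ k) (y 0 1 - 2 * (ln nu)%:C *~ k).
Proof.
have iter_word u (c : Cx R) n :
    (forall z, weyl_act l u z = row2 (z 0 0 + c) (z 0 1 - c)) ->
    exists w, weyl_act l w y = row2 (y 0 0 + c *+ n) (y 0 1 - c *+ n).
  move=> uE; elim: n => [|n [w wE]].
    by exists [::]; apply: row2P; rewrite ?row2_0 ?row2_1 mulr0n ?addr0 ?subr0.
  exists (u ++ w); rewrite /weyl_act foldr_cat -/(weyl_act l w y).
  rewrite -/(weyl_act l u _) wE uE !row2_0 !row2_1 mulrSr opprD !addrA.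
  by [].
case: k => n; last rewrite NegzE mulrNz -mulNrz.
  apply: (iter_word [:: 1; 0]) => z.
  by rewrite /= /reflection /= !row2_0 !row2_1; congr row2; ring.
apply: (iter_word [:: 0; 1]) => z.
by rewrite /= /reflection /= !row2_0 !row2_1; congr row2; ring.
Qed.

(** Equal $s^1$ means $P=P'$ or $PP'=-1$. In the first case $y^1-y^2$ changes by a multiple of $4\pi
    i/h=4\log\nu$, which a translation in $W$ realizes; a reflection reduces the second case to the
    first. *)
Lemma s_fun_inj y y' : s_fun y = s_fun y' -> exists w, weyl_act l w y = y'.
Proof.
case/row2_inj => eE es.
have P0 := cexp_neq0 (h / 2 * (y 0 0 - y 0 1)) : phase y != 0.
have P0' := cexp_neq0 (h / 2 * (y' 0 0 - y' 0 1)) : phase y' != 0.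
have main z : phase z = phase y' -> z 0 0 + z 0 1 = y' 0 0 + y' 0 1 ->
    exists w, weyl_act l w z = y'.
  move=> ze zs.
  have : cexp (h / 2 * (y' 0 0 - y' 0 1) - h / 2 * (z 0 0 - z 0 1)) = 1.
    by rewrite cexpD cexpN -/(phase z) ze divff.
  case/cexp_eq1 => k kE.
  have [w wE] := weyl_translation k z; exists w; rewrite {}wE.
  have {kE} : y' 0 0 - y' 0 1 - (z 0 0 - z 0 1) = 4 * (ln nu)%:C *~ k.
    apply: (mulfI (_ : h / 2 != 0)); first by rewrite mulf_neq0 ?hh_neq0 // invr_neq0.
    rewrite mulrBr kE [RHS]mulrzAr; congr (_ *~ k).
    rewrite (_ : h / 2 * _ = 2 * (h * (ln nu)%:C)); last by field.
    rewrite hh_ln_nu; apply/eqP; rewrite eq_complex /=.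
    by apply/andP; split; apply/eqP; ring.
  rewrite -mulrzl -[2 * _ *~ k]mulrzl; move: (k%:~R) => c kE.
  apply: row2P; rewrite ?row2_0 ?row2_1.
    rewrite (_ : _ + _ =
      ((z 0 0 + z 0 1) + (z 0 0 - z 0 1) + c * (4 * (ln nu)%:C)) / 2);
      last by field.
    by rewrite -kE zs; field.
  rewrite (_ : _ - _ =
    ((z 0 0 + z 0 1) - (z 0 0 - z 0 1) - c * (4 * (ln nu)%:C)) / 2);
    last by field.
  by rewrite -kE zs; field.
have : (phase y - phase y') * (phase y * phase y' + 1) = 0.
  rewrite (_ : _ * _ = phase y * phase y' *
    (phase y - (phase y)^-1 - (phase y' - (phase y')^-1))).
    by rewrite eE subrr mulr0.
  by field; rewrite P0 P0'.
move/eqP; rewrite mulf_eq0 subr_eq0 => /orP[/eqP /main|/eqP e]; first exact.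
have [] := main (reflection l 0 y).
- rewrite phase_reflection; apply: (mulfI P0); rewrite mulrN divff //.
  by rewrite -[RHS](addrK 1) e sub0r.
- by rewrite /reflection /= row2_0 row2_1 -es; ring.
by move=> w <-; exists (rcons w 0); rewrite /weyl_act foldr_rcons.
Qed.

Lemma s_coordE (p : orbit_space R l) :
  s_coord l p = s_fun (val (repr (p : {eq_quot weyl_equiv_rel l}%qT))).
Proof. exact: s_coverE. Qed.

Lemma s_coord_orbit (y : Xcover) : s_coord l (@Defs.orbit R l y) = s_fun (val y).
Proof.
have : (repr (@Defs.orbit R l y : {eq_quot weyl_equiv_rel l}%qT) = y
  %[mod {eq_quot weyl_equiv_rel l}%qT])%qT by rewrite reprK.
by move/eqmodP => /= /asboolP[w <-]; rewrite s_coordE s_fun_weyl.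
Qed.

Lemma s_coord_inj : injective (@s_coord R l).
Proof.
move=> p q; rewrite !s_coordE => /s_fun_inj[w pq].
rewrite -[p](reprK (p : {eq_quot weyl_equiv_rel l}%qT)).
rewrite -[RHS](reprK (q : {eq_quot weyl_equiv_rel l}%qT)).
by apply/eqmodP/asboolP; exists w.
Qed.

Lemma orbit_surj (p : orbit_space R l) : exists y, p = @Defs.orbit R l y.
Proof.
by exists (repr (p : {eq_quot weyl_equiv_rel l}%qT)); rewrite [RHS]reprK.
Qed.

(* The values of s^1 fill the interior of an ellipse with foci 2i and -2i:    *)
(* w - 2i and w + 2i are (E - i)^2 / E and (E + i)^2 / E for w = E - 1/E.     *)
Definition focal_sum (w : Cx R) : Cx R := `|w - 2 * 'i%C| + `|w + 2 * 'i%C|.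

Lemma focal_sumE (w : Cx R) : w != 0 ->
  focal_sum (w - w^-1) = 2 * (`|w| + `|w|^-1).
Proof.
move=> w0; have i2 : 'i%C * 'i%C = -1 :> Cx R by rewrite -expr2 sqr_i.
have n0 : `|w| != 0 by rewrite normr_eq0.
have e1 : w - w^-1 - 2 * 'i%C = (w - 'i%C) ^+ 2 / w.
  have -> : (w - 'i%C) ^+ 2 = w ^+ 2 - 2 * 'i%C * w - 1 by rewrite -i2; ring.
  by field.
have e2 : w - w^-1 + 2 * 'i%C = (w + 'i%C) ^+ 2 / w.
  have -> : (w + 'i%C) ^+ 2 = w ^+ 2 + 2 * 'i%C * w - 1 by rewrite -i2; ring.
  by field.
rewrite /focal_sum e1 e2 !normf_div !normrX -mulrDl.
have -> : `|w - 'i%C| ^+ 2 + `|w + 'i%C| ^+ 2 = 2 * (`|w| ^+ 2 + 1).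
  rewrite -!add_Re2_Im2; case: (w) => a b /=.
  by apply/eqP; rewrite eq_complex /=; apply/andP; split; apply/eqP; ring.
by field.
Qed.

(** The function $2\cosh$ is even and strictly increasing on the non-negative reals. *)
Lemma expR_sum_lt (t T : R) : 0 < T ->
  (expR t + expR (- t) < expR T + expR (- T)) = (`|t| < T).
Proof.
move=> T0.
have -> : expR t + expR (- t) = expR `|t| + expR (- `|t|).
  by case: (ger0P t) => // _; rewrite opprK addrC.
have := normr_ge0 t; move: `|t| => u u0.
have eq1 : expR T + expR (- T) - (expR u + expR (- u)) =
    (expR T - expR u) * (1 - expR (- (T + u))).
  rewrite [- (T + u)]opprD expRD !expRN; field.
  by rewrite !gt_eqF ?expR_gt0.
rewrite -subr_gt0 eq1 pmulr_lgt0 ?subr_gt0 ?ltr_expR //.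
by rewrite -expR0 ltr_expR; lra.
Qed.

(** On the cover, $|P|$ ranges strictly between $e^{-T}$ and $e^T$: this is the strip condition
    $|\mathrm{Im}(y^1-y^2)|<\pi$ rewritten. *)
Let T := pi * pi / (2 * ln nu).

Lemma norm_phase (y : 'rV[Cx R]_2) :
  `|phase y| = (expR (- (pi / (2 * ln nu)) * complex.Im (y 0 0 - y 0 1)))%:C.
Proof.
rewrite norm_cexp; congr ((expR _)%:C).
have -> : h / 2 = 0 +i* (pi / (2 * ln nu)).
  have L0 := lt0r_neq0 ln_nu_gt0.
  rewrite hhE -[2](rmorph_nat (real_complex R)) -fmorphV; apply/eqP.
  by rewrite eq_complex /=; apply/andP; split; apply/eqP; [ring | field; rewrite L0].
by case: (y 0 0 - y 0 1) => a b /=; ring.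
Qed.

(** The focal sum of $P-1/P$ is $2(|P|+1/|P|)$, so the ellipse inequality on $s^1$ is equivalent to
    the strip condition, while $s^2$ is unrestricted. *)
Lemma s_image (z : 'rV[Cx R]_2) :
  focal_sum (z 0 0) < (2 * (expR T + expR (- T)))%:C <->
  exists p, @s_coord R l p = z.
Proof.
have T0 : 0 < T by rewrite divr_gt0 ?mulr_gt0 ?pi_gt0 ?ln_nu_gt0.
have sum_phase y : focal_sum (s_fun y 0 0) < (2 * (expR T + expR (- T)))%:C <->
    `|complex.Im (y 0 0 - y 0 1)| < pi.
  rewrite row2_0 focal_sumE ?cexp_neq0 // norm_phase -fmorphV -expRN.
  rewrite -[2 in X in X < _](rmorph_nat (real_complex R)) -rmorphD -rmorphM /=.
  rewrite ltcR ltr_pM2l // expR_sum_lt // normrM normrN.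
  have pL : 0 < pi / (2 * ln nu) by rewrite divr_gt0 ?mulr_gt0 ?pi_gt0 ?ln_nu_gt0.
  rewrite (gtr0_norm pL).
  rewrite [T]mulrAC ltr_pM2l //.
split=> [zlt|[p <-]]; last first.
  have [y ->] := orbit_surj p; rewrite s_coord_orbit.
  by apply/sum_phase; case: y => y /= /set_mem.
(* A preimage needs a phase [w] with $w-1/w=z^1$, a root of $w^2-z^1w-1$; its logarithm [u] gives
   $y^1-y^2=2u/h$. *)
pose D := sqrtc (z 0 0 ^+ 2 + 4); pose w := (z 0 0 + D) / 2.
have wE : w ^+ 2 - z 0 0 * w - 1 = 0.
  have := sqr_sqrtc (z 0 0 ^+ 2 + 4); rewrite -/D /w => D2.
  rewrite (_ : _ - 1 = (D ^+ 2 - (z 0 0 ^+ 2 + 4)) / 4); last by field.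
  by rewrite D2 subrr mul0r.
have w0 : w != 0.
  apply/eqP => w0; move/eqP: wE; rewrite w0 expr0n mulr0 subr0 add0r.
  by rewrite oppr_eq0 oner_eq0.
have [u uw] := cexp_surj w0.
pose v := 2 * u / h; pose y := row2 ((z 0 1 + v) / 2) ((z 0 1 - v) / 2).
have sy : s_fun y = z.
  apply: row2P; rewrite ?row2_0 ?row2_1 /phase /y.
    rewrite !row2_0 !row2_1 (_ : h / 2 * _ = u) ?uw.
      apply: (mulfI w0); rewrite mulrBr divff //.
      by apply/eqP; rewrite -subr_eq0 -wE; apply/eqP; ring.
    by rewrite /v; field; exact: hh_neq0.
  by rewrite row2_0; field.
have yX : y \in (Xcover : set 'rV[Cx R]_2).
  by apply/mem_set/sum_phase; rewrite sy.
by exists (@Defs.orbit R l (SigSub yX : Xcover)); rewrite s_coord_orbit.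
Qed.

Lemma s_coord_open (p : orbit_space R l) :
  \forall z \near s_coord l p, exists q, s_coord l q = z.
Proof.
have : focal_sum (s_coord l p 0 0) < (2 * (expR T + expR (- T)))%:C.
  by apply/s_image; exists p.
rewrite -subr_gt0; set d := _ - _ => d0.
have /cvgrPdist_lt /(_ (d / 2)) := @coord_continuous (Cx R) 1 2 0 0 (s_coord l p).
rewrite divr_gt0 // => /(_ isT); apply: filterS => z zd; apply/s_image.
(* A move of $s^1$ by less than half the slack [d] increases each of the two focal distances by less
   than [d / 2]. *)
have tri (c : Cx R) :
    `|z 0 0 + c| <= `|s_coord l p 0 0 + c| + `|s_coord l p 0 0 - z 0 0|.
  rewrite (_ : z 0 0 + c = s_coord l p 0 0 + c - (s_coord l p 0 0 - z 0 0)).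
    exact: ler_normB.
  by ring.
have := lerD (tri (- (2 * 'i%C))) (tri (2 * 'i%C)); rewrite -/(focal_sum _).
move/le_lt_trans; apply; rewrite addrACA -/(focal_sum _).
have := ltrD zd zd; rewrite -splitr /d ltrBrDl => /lt_le_trans -> //.

Qed.

Lemma val_open (y : Xcover) :
  \forall z \near (val y : 'rV[Cx R]_2), exists q : Xcover, val q = z.
Proof.
pose d := pi - `|complex.Im (val y 0 0 - val y 0 1)|.
have d0 : 0 < d by rewrite subr_gt0; exact: set_mem (valP y).
have dC : 0 < (d / 2)%:C by rewrite ltcR divr_gt0.
have /cvgrPdist_lt /(_ _ dC) n0 := @coord_continuous (Cx R) 1 2 0 0 (val y).
have /cvgrPdist_lt /(_ _ dC) n1 := @coord_continuous (Cx R) 1 2 0 1 (val y).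
apply: filterS (filterI n0 n1) => z [z0 z1].
suff zX : z \in (Xcover : set 'rV[Cx R]_2) by exists (SigSub zX : Xcover).
apply/mem_set => /=; rewrite /Xcover /=.
have := le_lt_trans (normc_ge_Im _) z0; have := le_lt_trans (normc_ge_Im _) z1.
rewrite !ltcR /d.
case: (\val y 0 0) (\val y 0 1) (z 0 0) (z 0 1) => [a0 b0] [a1 b1] [c0 e0].
case=> c1 e1 /=.
have := ler_normD (b0 - b1 - (b0 - e0)) (b1 - e1).
have := ler_normB (b0 - b1) (b0 - e0).
rewrite (_ : b0 - b1 - (b0 - e0) + (b1 - e1) = e0 - e1); last by ring.
lra.
Qed.

End OrbitSpaceChart.

(** * The form g in the coordinates s *)

Lemma ord2P (i : 'I_2) : i = 0 \/ i = 1.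
Proof. by case: i => -[|[|//]] p; [left | right]; apply: val_inj. Qed.

Section TwoByTwo.
Context {K : fieldType}.

Lemma sum2 (V : zmodType) (F : 'I_2 -> V) : \sum_i F i = F 0 + F 1.
Proof.
rewrite !big_ord_recl big_ord0 addr0; congr (_ + F _); exact: val_inj.
Qed.

Definition mx2 (a b c d : K) : 'M[K]_2 :=
  \matrix_(i, j) if i == 0 then if j == 0 then a else b
                 else if j == 0 then c else d.

Lemma mx2E a b c d : (mx2 a b c d 0 0 = a) * (mx2 a b c d 0 1 = b)
  * (mx2 a b c d 1 0 = c) * (mx2 a b c d 1 1 = d).
Proof. by rewrite !mxE. Qed.

Lemma mx2P (A B : 'M[K]_2) : A 0 0 = B 0 0 -> A 0 1 = B 0 1 ->
  A 1 0 = B 1 0 -> A 1 1 = B 1 1 -> A = B.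
Proof.
by move=> *; apply/matrixP => i j; case: (ord2P i) (ord2P j) => -> [] ->.
Qed.

Lemma mx2_inv a b c d : a * d - b * c != 0 -> mx2 a b c d \in unitmx /\
  invmx (mx2 a b c d) = (a * d - b * c)^-1 *: mx2 d (- b) (- c) a.
Proof.
move=> D0; suff AB : mx2 a b c d *m ((a * d - b * c)^-1 *: mx2 d (- b) (- c) a) = 1%:M.
  have [uA _] := mulmx1_unit AB; split=> //.
  by rewrite -[RHS]mul1mx -(mulVmx uA) -mulmxA AB mulmx1.
by apply: mx2P; rewrite !mxE sum2 !mxE /=; field.
Qed.

End TwoByTwo.

Section CoverForm.
Context {R : realType}.
Variable l : nat.
Hypothesis l_ge3 : (3 <= l)%N.
Local Notation h := (hh R l).

Let cv := (fun z : @Xcover R => \val z).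

Let cv_inj : injective cv. Proof. exact: val_inj. Qed.

Let cv_open : forall p, \forall z \near cv p, exists q, cv q = z.
Proof. exact: val_open. Qed.

(** Isotropy is the relation $\nu^2-\ell\nu+1=0$; the value $-1$ comes from this relation and the
    normalization $c^2(\ell^2-4)\nu=1$. *)
Lemma Iform_beta (i j : 'I_2) :
  Iform l (beta l i) (beta l j) = if i == j then 0 else -1 :> Cx R.
Proof.
have nu0 : 0 < nu l :> R := lt_trans ltr01 (nu_gt1 l_ge3).
have D0 : 0 < (l%:R ^+ 2 - 4) * nu l :> R.
  rewrite mulr_gt0 // subr_gt0; have : 3 <= l%:R :> R by rewrite (ler_nat R 3).
  nra.
rewrite /Iform /beta; set c : Cx R := (_^-1)%:C.
have c2 : c ^+ 2 * ((l%:R ^+ 2 - 4) * (nu l)%:C) = 1.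
  have -> : (l%:R ^+ 2 - 4) * (nu l)%:C = ((l%:R ^+ 2 - 4) * nu l)%:C :> Cx R.
    by rewrite [RHS](rmorphM (real_complex R)) /= rmorphB rmorphXn !rmorph_nat.
  rewrite -rmorphXn -rmorphM exprVn sqr_sqrtr ?mulVf ?rmorph1 //; first exact: lt0r_neq0.
  exact: ltW.
have nu2 : (nu l)%:C ^+ 2 = l%:R * (nu l)%:C - 1 :> Cx R.
  have -> : (l%:R * (nu l)%:C - 1 : Cx R) = (l%:R * nu l - 1)%:C.
    rewrite -[in LHS](rmorph_nat (real_complex R)); apply/eqP; rewrite eq_complex /=.
    by apply/andP; split; apply/eqP; ring.
  rewrite -rmorphXn; congr (_%:C); have := @nu_quadratic R l l_ge3; lra.
move: c ((nu l)%:C : Cx R) nu2 c2 => c n nu2 c2.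
case: (ord2P i) (ord2P j) => -> [] ->; rewrite !mxE sum2 !mxE !sum2 !mxE /=.
- rewrite (_ : _ + _ = 2 * c ^+ 2 * (n ^+ 2 - (l%:R * n - 1))); last by ring.
  by rewrite nu2 subrr mulr0.
- rewrite (_ : _ + _ = - (c ^+ 2 * ((l%:R ^+ 2 - 4) * n))
    - l%:R * c ^+ 2 * (n ^+ 2 - (l%:R * n - 1))); last by ring.
  by rewrite nu2 c2 subrr mulr0 subr0.
- rewrite (_ : _ + _ = - (c ^+ 2 * ((l%:R ^+ 2 - 4) * n))
    - l%:R * c ^+ 2 * (n ^+ 2 - (l%:R * n - 1))); last by ring.
  by rewrite nu2 c2 subrr mulr0 subr0.
- rewrite (_ : _ + _ = 2 * c ^+ 2 * (n ^+ 2 - (l%:R * n - 1))); last by ring.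
  by rewrite nu2 subrr mulr0.
Qed.

(** Since $dx^i=e^{y^i}dy^i$, the only non-zero value on the frame $dy^i$ is
    $g(dy^1,dy^2)=-e^{-(y^1+y^2)}$. *)
Lemma gformE y (w w' : 'cV[Cx R]_2) w0 w1 w0' w1' :
  w 0 0 = w0 -> w 1 0 = w1 -> w' 0 0 = w0' -> w' 1 0 = w1' ->
  gform l y w w' = - (w0 * w1' + w1 * w0') / cexp (cv y 0 0 + cv y 0 1).
Proof.
move=> <- <- <- <-.
have X0 := cexp_neq0 (cv y 0 0); have X1 := cexp_neq0 (cv y 0 1).
have J : jacobian_matrix cv covering y = mx2 (cexp (cv y 0 0)) 0 0 (cexp (cv y 0 1)).
  have pd a i : pderiv cv a (fun q => covering q 0 i) y = cexp (cv y 0 i) * (a == i)%:R.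
    rewrite -(pderiv_coord cv_inj cv_open a i y).
    rewrite -(pderiv_comp1 cv_inj _ _ (holomorphic_coord cv_inj cv_open i) is_derive_cexp).
    by congr pderiv; apply/funext => q; rewrite mxE.
  by apply: mx2P; rewrite mx2E mxE pd ?mulr1 ?mulr0.
have cov (v : 'cV[Cx R]_2) : covector_in cv covering y v =
    \col_i (v i 0 / cexp (cv y 0 i)).
  rewrite /covector_in J (mx2_inv _).2; last by rewrite mulr0 subr0 mulf_neq0.
  apply/matrixP => i j; rewrite (ord1 j) mxE sum2 !mxE.
  by case: (ord2P i) => -> /=; field; rewrite X0 X1.
have sum4 (v v' : 'I_2 -> Cx R) (I : 'I_2 -> 'I_2 -> Cx R) :
    (forall i j, I i j = if i == j then 0 else -1) ->
    \sum_i \sum_j v i * I i j * v' j = - (v 0 * v' 1 + v 1 * v' 0).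
  by move=> IE; rewrite !sum2 !IE /=; ring.
rewrite /gform (sum4 _ _ _ Iform_beta) !cov !mxE cexpD.
move: (cexp _) (cexp _) X0 X1 => X Y X0 X1.
by field; rewrite X0 X1.
Qed.

Lemma gform_orbit (f f' : orbit_space R l -> Cx R) y :
  holomorphic (s_coord l) f -> holomorphic (s_coord l) f' ->
  let p := Defs.orbit l y in
  gform l y (differential cv (f \o @Defs.orbit R l) y)
    (differential cv (f' \o @Defs.orbit R l) y) =
  (h ^+ 2 / 2 * (s_coord l p 0 0 ^+ 2 + 4)
     * (pderiv (s_coord l) 0 f p * pderiv (s_coord l) 0 f' p)
   - 2 * (pderiv (s_coord l) 1 f p * pderiv (s_coord l) 1 f' p))
  / cexp (s_coord l p 0 1).
Proof.
move=> hf hf' p.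
have sE q : s_coord l (Defs.orbit l q) = s_cover l q.
  by rewrite s_coord_orbit // s_coverE.
have hc i := holomorphic_coord cv_inj cv_open i.
have cexp_diff (z : Cx R) : derivable cexp z (1 : Cx R) by case: (is_derive_cexp z).
have hC := holomorphic_cst cv (h / 2).
have hN j := holomorphicN (hc j).
have hD i j := holomorphicD (hc i) (hN j).
have harg i j := holomorphicM hC (hD i j).
have hexp i j := holomorphic_comp1 (harg i j) cexp_diff.
have hexpN i j := holomorphicN (hexp i j).
have s0E : (fun q => s_coord l (Defs.orbit l q) 0 0) =
    (fun q => cexp (h / 2 * (cv q 0 0 - cv q 0 1))
              + - cexp (h / 2 * (cv q 0 1 - cv q 0 0))).
  by apply/funext => q; rewrite sE row2_0.
have s1E : (fun q => s_coord l (Defs.orbit l q) 0 1) = (fun q => cv q 0 0 + cv q 0 1).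
  by apply/funext => q; rewrite sE row2_1.
have hs a : holomorphic cv (fun q => s_coord l (Defs.orbit l q) 0 a).
  case: (ord2P a) => ->.
    rewrite s0E; exact: holomorphicD (hexp 0 1) (hexpN 1 0).
  rewrite s1E; exact: holomorphicD (hc 0) (hc 1).
have dc i k : pderiv cv k (fun q => cv q 0 i) y = (k == i)%:R.
  exact: pderiv_coord cv_inj cv_open k i y.
have darg i j k : pderiv cv k (fun q => h / 2 * (cv q 0 i - cv q 0 j)) y =
    h / 2 * ((k == i)%:R - (k == j)%:R).
  rewrite (pderivM cv_inj k y hC (hD i j)) (pderivD k y (hc i) (hN j)).
  by rewrite (pderivN k y (hc j)) !dc pderiv_cst mulr0 addr0.
have dexp i j k : pderiv cv k (fun q => cexp (h / 2 * (cv q 0 i - cv q 0 j))) y =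
    cexp (h / 2 * (cv y 0 i - cv y 0 j)) * (h / 2 * ((k == i)%:R - (k == j)%:R)).
  by rewrite (pderiv_comp1 cv_inj k y (harg i j) is_derive_cexp) darg.
(* Here $ds^1=K(dy^1-dy^2)$ and $ds^2=dy^1+dy^2$, so these are $g$-orthogonal, and
   $K^2=\frac{h^2}{4}((s^1)^2+4)$ is a function on the quotient. *)
pose K := h / 2 * (phase l (cv y) + (phase l (cv y))^-1).
have phaseV : cexp (h / 2 * (cv y 0 1 - cv y 0 0)) = (phase l (cv y))^-1.
  by rewrite -cexpN -mulrN opprB.
have ds0 k : pderiv cv k (fun q => s_coord l (Defs.orbit l q) 0 0) y =
    if k == 0 then K else - K.
  rewrite s0E (pderivD k y (hexp 0 1) (hexpN 1 0)) (pderivN k y (hexp 1 0)).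
  rewrite !dexp phaseV -/(phase l (cv y)) /K.
  by case: (ord2P k) => -> /=; ring.
have ds1 k : pderiv cv k (fun q => s_coord l (Defs.orbit l q) 0 1) y = 1.
  rewrite s1E (pderivD k y (hc 0) (hc 1)) !dc.
  by case: (ord2P k) => -> /=; ring.
have df g k : holomorphic (s_coord l) g ->
    differential cv (g \o @Defs.orbit R l) y k 0 =
    pderiv (s_coord l) 0 g p * (if k == 0 then K else - K) + pderiv (s_coord l) 1 g p.
  move=> hg; rewrite mxE (pderiv_chain (s_coord_inj l_ge3) hs cv_inj k y hg).
  rewrite sum2 ds0 ds1.
  by move: (pderiv _ 0 g _) (pderiv _ 1 g _) => u v; rewrite mulr1.
have P0 : phase l (cv y) != 0 by exact: cexp_neq0.
have -> : s_coord l p 0 0 = phase l (cv y) - (phase l (cv y))^-1.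
  by rewrite sE s_coverE row2_0.
have -> : s_coord l p 0 1 = cv y 0 0 + cv y 0 1 by rewrite sE s_coverE row2_1.
rewrite (gformE _ (df f 0 hf) (df f 1 hf) (df f' 0 hf') (df f' 1 hf')) /K.
have T0 := cexp_neq0 (cv y 0 0 + cv y 0 1).
move: (pderiv _ 0 f _) (pderiv _ 1 f _) (pderiv _ 0 f' _) (pderiv _ 1 f' _).
move: (cexp _) (phase _ _) T0 P0 => T P T0 P0 f0 f1 f0' f1' /=.
by field; rewrite P0 T0.
Qed.

End CoverForm.

(** * Existence *)

Section FrameFormulas.
Context {R : realType} {n : nat} {M : topologicalType}.
Variable x : M -> 'rV[Cx R]_n.

Lemma vapply_frame a f p : vapply x (frame a) f p = pderiv x a f p.
Proof.
rewrite /vapply (bigD1 a) //= big1 ?addr0 ?mxE ?eqxx ?mul1r // => i ia.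
by rewrite mxE (negPf ia) mul0r.
Qed.

Lemma levi_civita_frame eta a w p c :
  levi_civita x eta (frame a) w p 0 c =
  pderiv x a (fun q => w q 0 c) p + \sum_b w p 0 b * christoffel x eta p a b c.
Proof.
rewrite mxE vapply_frame; congr (_ + _).
rewrite (bigD1 a) //= [X in _ + X]big1 ?addr0 => [|i ia].
  by apply: eq_bigr => b _; rewrite mxE !eqxx mul1r.
by apply: big1 => b _; rewrite mxE (negPf ia) !mul0r.
Qed.

Lemma frameE (a : 'I_n) (p : M) c : frame (R := R) a p 0 c = (c == a)%:R.
Proof. by rewrite mxE. Qed.

Lemma pderiv_frame (a b c : 'I_n) p : pderiv x a (fun q => frame b q 0 c) p = 0.
Proof. exact: pderiv_cst. Qed.

Lemma levi_civita_frames eta a b p c :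
  levi_civita x eta (frame a) (frame b) p 0 c = christoffel x eta p a b c.
Proof.
rewrite levi_civita_frame pderiv_frame add0r (bigD1 b) //= big1 ?addr0 => [|i ib].
  by rewrite mxE !eqxx mul1r.
by rewrite mxE (negPf ib) mul0r.
Qed.

Lemma levi_civita0 eta w p : levi_civita x eta (fun=> 0) w p = 0.
Proof.
apply/rowP => c; rewrite mxE [RHS]mxE.
have -> : vapply x (fun=> 0) (fun q => w q 0 c) p = 0.
  by apply: big1 => a _; rewrite mxE mul0r.
rewrite add0r; apply: big1 => a _; apply: big1 => b _.
by rewrite mxE !mul0r.
Qed.

Lemma bracket_cst v a : bracket x (fun=> v) (frame a) = fun=> 0.
Proof.
have vapply_cst w (f : M -> Cx R) p :
    (forall b, pderiv x b f p = 0) -> vapply x w f p = 0.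
  by move=> f0; apply: big1 => b _; rewrite f0 mulr0.
apply/funext => p; apply/rowP => c; rewrite [LHS]mxE [RHS]mxE.
rewrite (vapply_cst _ _ _ (fun b => pderiv_frame b a c p)).
by rewrite (vapply_cst _ _ _ (fun b => pderiv_cst x b (v 0 c) p)) subrr.
Qed.

Lemma pairing_frame (eta : M -> 'M[Cx R]_n) a b :
  pairing eta (frame a) (frame b) = fun p => eta p a b.
Proof.
by apply/funext => p; rewrite /pairing /frame -rowE trmx_delta -colE !mxE.
Qed.

End FrameFormulas.

(** * Calculus in the chart s and the vector fields of t *)

Section SCalculus.
Context {R : realType}.
Variable l : nat.
Hypothesis l_ge3 : (3 <= l)%N.
Local Notation M := (orbit_space R l).
Local Notation x := (s_coord l : M -> _).
Local Notation h := (hh R l).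

Let x_inj := @s_coord_inj R l l_ge3.
Let x_open := @s_coord_open R l l_ge3.

(** Locked, like [exp_s1] below, so that simplification and unification treat it as an atom. *)
Definition s0 (p : M) : Cx R := locked (x p 0 0).

Lemma s0E p : s0 p = x p 0 0. Proof. by rewrite /s0 -lock. Qed.

Definition exp_s1 (c : Cx R) (p : M) : Cx R := locked (cexp (c * x p 0 1)).

Lemma exp_s1E c p : exp_s1 c p = cexp (c * x p 0 1).
Proof. by rewrite /exp_s1 -lock. Qed.

Lemma exp_s1_neq0 c p : exp_s1 c p != 0.
Proof. by rewrite exp_s1E cexp_neq0. Qed.

Lemma exp_s1_0 p : exp_s1 0 p = 1.
Proof. by rewrite exp_s1E mul0r cexp0. Qed.

Lemma exp_s1D c d p : exp_s1 (c + d) p = exp_s1 c p * exp_s1 d p.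
Proof. by rewrite !exp_s1E mulrDl cexpD. Qed.

Lemma exp_s1N c p : exp_s1 (- c) p = (exp_s1 c p)^-1.
Proof. by rewrite !exp_s1E mulNr cexpN. Qed.

(* The functions P(s^1) exp(d s^2) with deg P <= 2 are stable under both      *)
(* partial derivatives and contain all components of the structure.           *)
Definition quad_exp (a b c d : Cx R) (p : M) : Cx R :=
  (a + b * s0 p + c * s0 p ^+ 2) * exp_s1 d p.

Lemma quad_exp_calc a b c d :
  [/\ holomorphic x (quad_exp a b c d),
      pderiv x 0 (quad_exp a b c d) = quad_exp b (2 * c) 0 d
    & pderiv x 1 (quad_exp a b c d) = quad_exp (d * a) (d * b) (d * c) d].
Proof.
have hcst := holomorphic_cst x.
have s0_fun : s0 = fun p => x p 0 0 by apply/funext => p; rewrite s0E.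
have hs : holomorphic x s0 by rewrite s0_fun; exact: (holomorphic_coord x_inj x_open).
have cexp_diff (z : Cx R) : derivable cexp z (1 : Cx R) by case: (is_derive_cexp z).
have h1 : holomorphic x (fun p => x p 0 1) := holomorphic_coord x_inj x_open 1.
have harg := holomorphicM (hcst d) h1.
have e_fun : exp_s1 d = fun p => cexp (d * x p 0 1).
  by apply/funext => p; rewrite exp_s1E.
have hexp : holomorphic x (exp_s1 d).
  by rewrite e_fun; exact: holomorphic_comp1 harg cexp_diff.
have hb := holomorphicM (hcst b) hs.
have hs2 := holomorphicM hs hs.
have hc := holomorphicM (hcst c) hs2.
have hab := holomorphicD (hcst a) hb.
have hq := holomorphicD hab hc.
have ds i p : pderiv x i s0 p = (i == 0)%:R.
  by rewrite s0_fun; exact: (pderiv_coord x_inj x_open).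
have de i p : pderiv x i (exp_s1 d) p = d * exp_s1 d p * (i == 1)%:R.
  rewrite {1}e_fun (pderiv_comp1 x_inj i p harg is_derive_cexp) -exp_s1E.
  rewrite (pderivM x_inj i p (hcst d) h1) (pderiv_coord x_inj x_open) pderiv_cst.
  by move: (exp_s1 d p) => e; ring.
have pd i p : pderiv x i (quad_exp a b c d) p =
    (b + 2 * c * s0 p) * exp_s1 d p * (i == 0)%:R
    + quad_exp (d * a) (d * b) (d * c) d p * (i == 1)%:R.
  rewrite /quad_exp (pderivM x_inj i p hq hexp) (pderivD i p hab hc).
  rewrite (pderivD i p (hcst a) hb) (pderivM x_inj i p (hcst b) hs).
  rewrite (pderivM x_inj i p (hcst c) hs2) (pderivM x_inj i p hs hs).
  rewrite 3!pderiv_cst ds de.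
  by move: (exp_s1 d p) (s0 p) => e s; ring.
split.
- exact: (holomorphicM hq hexp).
- by apply/funext => p; rewrite pd /quad_exp /=; ring.
- by apply/funext => p; rewrite pd /quad_exp /=; ring.
Qed.

Lemma t_coord0 p : t_coord l p 0 0 = exp_s1 (h / 2) p * s0 p.
Proof. by rewrite exp_s1E s0E; exact: row2_0. Qed.

Lemma t_coord1 p : t_coord l p 0 1 = exp_s1 1 p.
Proof. by rewrite exp_s1E mul1r; exact: row2_1. Qed.

Lemma t_coord0_fun : (fun p => t_coord l p 0 0) = quad_exp 0 1 0 (h / 2).
Proof. by apply/funext => p; rewrite t_coord0 /quad_exp; ring. Qed.

Lemma t_coord1_fun : (fun p => t_coord l p 0 1) = quad_exp 1 0 0 1.
Proof. by apply/funext => p; rewrite t_coord1 /quad_exp; ring. Qed.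

Lemma jacobianE p : jacobian_matrix x (t_coord l) p =
  mx2 (exp_s1 (h / 2) p) 0 (h / 2 * (exp_s1 (h / 2) p * s0 p)) (exp_s1 1 p).
Proof.
have [_ p00 p10] := quad_exp_calc 0 1 0 (h / 2).
have [_ p01 p11] := quad_exp_calc 1 0 0 1.
by apply: mx2P; rewrite mx2E mxE ?t_coord0_fun ?t_coord1_fun ?p00 ?p01 ?p10 ?p11
  /quad_exp; ring.
Qed.

Lemma jacobian_inv p : jacobian_matrix x (t_coord l) p \in unitmx /\
  invmx (jacobian_matrix x (t_coord l) p) =
  mx2 (exp_s1 (h / 2) p)^-1 0 (- (h / 2) * s0 p / exp_s1 1 p) (exp_s1 1 p)^-1.
Proof.
have e0 := exp_s1_neq0 (h / 2) p; have e1 := exp_s1_neq0 1 p.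
have [|u i] := @mx2_inv _ (exp_s1 (h / 2) p) 0 (h / 2 * (exp_s1 (h / 2) p * s0 p))
  (exp_s1 1 p); first by rewrite mul0r subr0 mulf_neq0.
rewrite jacobianE i; split=> //.
by apply: mx2P; rewrite !mxE /=; field; rewrite ?e0 ?e1.
Qed.

Lemma local_coordinates_t : local_coordinates x (t_coord l).
Proof.
split=> [i|p]; last exact: (jacobian_inv p).1.
case: (ord2P i) => ->.
  by rewrite t_coord0_fun; case: (quad_exp_calc 0 1 0 (h / 2)).
by rewrite t_coord1_fun; case: (quad_exp_calc 1 0 0 1).
Qed.

Lemma dt0E : coord_vfield x (t_coord l) 0 =
  fun p => row2 (quad_exp 1 0 0 (- (h / 2)) p) 0.
Proof.
apply/funext => p; apply: row2P; rewrite !mxE (jacobian_inv p).2 mx2E //.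
by rewrite /quad_exp exp_s1N /=; ring.
Qed.

Lemma dt1E : coord_vfield x (t_coord l) 1 =
  fun p => row2 (quad_exp 0 (- (h / 2)) 0 (- 1) p) (quad_exp 1 0 0 (- 1) p).
Proof.
apply/funext => p; apply: row2P; rewrite !mxE (jacobian_inv p).2 mx2E //;
by rewrite /quad_exp exp_s1N /=; ring.
Qed.

(** The term $t^1\partial_{t^1}=s^1\partial_{s^1}$ cancels the $\partial_{s^1}$-part of
    $\frac2ht^2\partial_{t^2}$, leaving a constant field in the chart. *)
Lemma eulerE : (fun p : M =>
    t_coord l p 0 0 *: coord_vfield (s_coord l) (t_coord l) 0 p
    + (2 / h * t_coord l p 0 1) *: coord_vfield (s_coord l) (t_coord l) 1 p) =
  fun=> row2 0 (2 / h).
Proof.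
have h0 := @hh_neq0 R l l_ge3.
apply/funext => p; have e0 := exp_s1_neq0 (h / 2) p; have e1 := exp_s1_neq0 1 p.
rewrite dt0E dt1E t_coord0 t_coord1 /quad_exp !exp_s1N.
by apply: row2P; rewrite !mxE /=; field; rewrite ?e0 ?e1 ?h0.
Qed.

End SCalculus.

(** * The explicit structure in the frame of s *)

Section FrobeniusStructure.
Context {R : realType}.
Variable l : nat.
Hypothesis l_ge3 : (3 <= l)%N.
Local Notation M := (orbit_space R l).
Local Notation x := (s_coord l : M -> _).
Local Notation h := (hh R l).

Let h0 : h != 0. Proof. exact: hh_neq0. Qed.

(** Homogeneity of $\eta$ forces this exponent: $\frac2hk=1+\frac2h=2-d$. *)
Let k : Cx R := 1 + h / 2.

(** The constant form $-\frac1h(dt^1\otimes dt^2+dt^2\otimes dt^1)$ written in the frame of $s$. *)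
Definition eta_s (p : M) : 'M[Cx R]_2 :=
  mx2 0 (quad_exp (- h^-1) 0 0 k p) (quad_exp (- h^-1) 0 0 k p)
        (quad_exp 0 (- 1) 0 k p).

(** Index 0 acts as $e^{hs^2/2}$ times the unit; the last case is
    $\partial_{t^2}\circ\partial_{t^2}=-h^2e^{(h-2)s^2}\partial_{t^1}$ rewritten in the frame of
    $s$. *)
Definition mul_s (p : M) (a b : 'I_2) : 'rV[Cx R]_2 :=
  if a == 0 then
    if b == 0 then row2 (quad_exp 1 0 0 (h / 2) p) 0
    else row2 0 (quad_exp 1 0 0 (h / 2) p)
  else if b == 0 then row2 0 (quad_exp 1 0 0 (h / 2) p)
  else row2 (quad_exp (- h ^+ 2) 0 (- (h ^+ 2 / 4)) (h / 2) p)
            (quad_exp 0 h 0 (h / 2) p).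

Definition frob_s : @frobenius_data R 2 M := FrobeniusData
  eta_s mul_s (fun p => row2 (quad_exp 1 0 0 (- (h / 2)) p) 0) (fun=> row2 0 (2 / h)).

Let E (p : M) : Cx R := exp_s1 1 p.
Let Q (p : M) : Cx R := exp_s1 (h / 2) p.

Let E0 p : E p != 0. Proof. exact: exp_s1_neq0. Qed.
Let Q0 p : Q p != 0. Proof. exact: exp_s1_neq0. Qed.

Let quad_k a b c p : quad_exp a b c k p = (a + b * s0 p + c * s0 p ^+ 2) * (E p * Q p).
Proof. by rewrite /quad_exp /k exp_s1D. Qed.

Let quad_h a b c p : quad_exp a b c (h / 2) p = (a + b * s0 p + c * s0 p ^+ 2) * Q p.
Proof. by []. Qed.

Lemma eta_sE p : eta_s p =
  mx2 0 (- h^-1 * (E p * Q p)) (- h^-1 * (E p * Q p)) (- s0 p * (E p * Q p)).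
Proof. by rewrite /eta_s !quad_k; congr mx2; ring. Qed.

Lemma eta_s_inv p : eta_s p \in unitmx /\ invmx (eta_s p) =
  mx2 (h ^+ 2 * s0 p / (E p * Q p)) (- h / (E p * Q p)) (- h / (E p * Q p)) 0.
Proof.
have e0 := E0 p; have q0 := Q0 p; rewrite eta_sE.
move: (E p) (Q p) (s0 p) e0 q0 => e q s e0 q0.
have [|-> ->] := @mx2_inv _ 0 (- h^-1 * (e * q)) (- h^-1 * (e * q)) (- s * (e * q)).
  by rewrite mul0r sub0r oppr_eq0 !mulf_neq0 // oppr_eq0 invr_neq0.
by split=> //; apply: mx2P; rewrite !mxE /=; field; rewrite ?h0 ?e0 ?q0.
Qed.

Lemma eta_s_pderiv a b : holomorphic x (fun p => eta_s p a b) /\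
  forall p, pderiv x 0 (fun q => eta_s q a b) p = mx2 0 0 0 (- (E p * Q p)) a b /\
            pderiv x 1 (fun q => eta_s q a b) p = k * eta_s p a b.
Proof.
have entry i j a' b' c' : (forall p, eta_s p i j = quad_exp a' b' c' k p) ->
   [/\ holomorphic x (fun p => eta_s p i j),
     pderiv x 0 (fun q => eta_s q i j) = quad_exp b' (2 * c') 0 k
   & pderiv x 1 (fun q => eta_s q i j) = quad_exp (k * a') (k * b') (k * c') k].
  by move=> ij; rewrite (_ : (fun p => _) = quad_exp a' b' c' k);
    [exact: quad_exp_calc | exact/funext].
have e00 p : eta_s p 0 0 = quad_exp 0 0 0 k p.
  by rewrite mx2E /quad_exp; ring.
have e01 p : eta_s p 0 1 = quad_exp (- h^-1) 0 0 k p by rewrite mx2E.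
have e10 p : eta_s p 1 0 = quad_exp (- h^-1) 0 0 k p by rewrite mx2E.
have e11 p : eta_s p 1 1 = quad_exp 0 (- 1) 0 k p by rewrite mx2E.
case: (ord2P a) (ord2P b) => -> [] ->.
- have [hol d0 d1] := entry _ _ _ _ _ e00.
  by split=> // p; rewrite d0 d1 e00 mx2E !quad_k; split; ring.
- have [hol d0 d1] := entry _ _ _ _ _ e01.
  by split=> // p; rewrite d0 d1 e01 mx2E !quad_k; split; ring.
- have [hol d0 d1] := entry _ _ _ _ _ e10.
  by split=> // p; rewrite d0 d1 e10 mx2E !quad_k; split; ring.
- have [hol d0 d1] := entry _ _ _ _ _ e11.
  by split=> // p; rewrite d0 d1 e11 mx2E !quad_k; split; ring.
Qed.

(** The connection for which $t^1,t^2$ are affine: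
    $\Gamma_{ab}^c=\sum_i(\partial_a\partial_bt^i)\,\partial s^c/\partial t^i$. The only
    non-constant symbol is linear in $s^1$. *)
Definition christoffel_s (s : Cx R) (a b c : 'I_2) : Cx R :=
  if c == 0 then
    if a == 0 then if b == 0 then 0 else h / 2
    else if b == 0 then h / 2 else (h ^+ 2 / 4 - h / 2) * s
  else if (a == 1) && (b == 1) then 1 else 0.

Lemma christoffel_sE p a b c :
  christoffel x eta_s p a b c = christoffel_s (s0 p) a b c.
Proof.
have d0 i j := (proj2 (eta_s_pderiv i j) p).1.
have d1 i j := (proj2 (eta_s_pderiv i j) p).2.
rewrite /christoffel (eta_s_inv p).2 sum2.
have e0 := E0 p; have q0 := Q0 p.
case: (ord2P a) (ord2P b) (ord2P c) => -> [] -> [] ->;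
rewrite ?d0 ?d1 ?eta_sE !mx2E /christoffel_s /k /=;
move: (E p) (Q p) (s0 p) e0 q0 => e q s e0 q0;
by field; rewrite ?h0 ?e0 ?q0.
Qed.

Lemma frob_prod_s p u v : frob_prod frob_s p u v =
  row2 (u 0 0 * v 0 0 * Q p - u 0 1 * v 0 1 * (h ^+ 2 * (1 + s0 p ^+ 2 / 4) * Q p))
       ((u 0 0 * v 0 1 + u 0 1 * v 0 0) * Q p + u 0 1 * v 0 1 * (h * s0 p * Q p)).
Proof.
rewrite /frob_prod !sum2 /= /mul_s /= !quad_h.
have Z c a b : c *: row2 a b = row2 (c * a) (c * b) :> 'rV[Cx R]_2.
  by apply: row2P; rewrite mxE ?row2_0 ?row2_1.
have D a b c d : row2 a b + row2 c d = row2 (a + c) (b + d) :> 'rV[Cx R]_2.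
  by apply: row2P; rewrite mxE ?row2_0 ?row2_1.
rewrite !Z !D; move: (u 0 0) (u 0 1) (v 0 0) (v 0 1) (Q p) (s0 p) => u0 u1 v0 v1 q s.
congr row2; by field.
Qed.

Lemma levi_civita_s b f g p :
  levi_civita x eta_s (frame b) (fun q => row2 (f q) (g q)) p =
  row2 (pderiv x b f p + f p * christoffel_s (s0 p) b 0 0
          + g p * christoffel_s (s0 p) b 1 0)
       (pderiv x b g p + f p * christoffel_s (s0 p) b 0 1
          + g p * christoffel_s (s0 p) b 1 1).
Proof.
have f_fun : (fun q => row2 (f q) (g q) 0 0) = f by apply/funext => q; rewrite row2_0.
have g_fun : (fun q => row2 (f q) (g q) 0 1) = g by apply/funext => q; rewrite row2_1.
have G a c : christoffel x eta_s p b a c = christoffel_s (s0 p) b a c.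
  exact: christoffel_sE.
by apply: row2P; rewrite ?row2_0 ?row2_1 levi_civita_frame sum2 row2_0 row2_1 !G
  ?f_fun ?g_fun addrA.
Qed.

Lemma levi_civita_frame_s b c : levi_civita x eta_s (frame b) (frame c) =
  fun p => row2 (christoffel_s (s0 p) b c 0) (christoffel_s (s0 p) b c 1).
Proof.
apply/funext => p; apply: row2P; rewrite ?row2_0 ?row2_1 levi_civita_frames;
exact: christoffel_sE.
Qed.

Lemma pderiv_christoffel_s a b c d p :
  pderiv x a (fun q => christoffel_s (s0 q) b c d) p =
  if [&& a == 0, b == 1, c == 1 & d == 0] then h ^+ 2 / 4 - h / 2 else 0.
Proof.
have [_ d0 d1] := quad_exp_calc l_ge3 0 (h ^+ 2 / 4 - h / 2) 0 0.
have G_fun : (fun q : M => (h ^+ 2 / 4 - h / 2) * s0 q) =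
    quad_exp 0 (h ^+ 2 / 4 - h / 2) 0 0.
  apply/funext => q; rewrite /quad_exp exp_s1_0.
  by move: (s0 q) => s; ring.
case: (ord2P b) (ord2P c) (ord2P d) => -> [] -> [] ->;
  rewrite /christoffel_s /= ?andbF ?pderiv_cst //.
rewrite G_fun; case: (ord2P a) => -> /=; rewrite ?d0 ?d1 /quad_exp exp_s1_0.
  by move: (s0 p) => s; ring.
by move: (s0 p) => s; ring.
Qed.

Lemma flat_s a b c p : curvature x eta_s (frame a) (frame b) (frame c) p = 0.
Proof.
rewrite /curvature (bracket_cst x (delta_mx 0 a) b) levi_civita0 subr0.
rewrite !levi_civita_frame_s !levi_civita_s.
apply: row2P;
rewrite mxE [(- _ : 'rV_2) _ _]mxE ?row2_0 ?row2_1 !pderiv_christoffel_s [RHS]mxE;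
move: (s0 p) => s;
case: (ord2P a) (ord2P b) (ord2P c) => -> [] -> [] ->; rewrite /christoffel_s /=; by field.
Qed.

Lemma vprod_frame a b : vprod frob_s (frame a) (frame b) = fun p => mul_s p a b.
Proof.
apply/funext => p; rewrite /vprod frob_prod_s /mul_s.
case: (ord2P a) (ord2P b) => -> [] ->; rewrite !mxE /= !quad_h;
by apply: row2P; rewrite !mxE /=; move: (Q p) (s0 p) => q s; field.
Qed.

Let coef (a b c : 'I_2) : Cx R * Cx R * Cx R :=
  if a == 0 then ((b == c)%:R, 0, 0)
  else if b == 0 then ((a == c)%:R, 0, 0)
  else if c == 0 then (- h ^+ 2, 0, - (h ^+ 2 / 4)) else (0, h, 0).

Lemma mul_sE (p : M) a b c : mul_s p a b 0 c =
  quad_exp (coef a b c).1.1 (coef a b c).1.2 (coef a b c).2 (h / 2) p.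
Proof.
case: (ord2P a) (ord2P b) (ord2P c) => -> [] -> [] ->;
by rewrite /mul_s /coef /= ?row2_0 ?row2_1 ?quad_h //; move: (Q p) (s0 p) => q s; ring.
Qed.

Lemma mul_s_calc a b c :
  [/\ holomorphic x (fun p => mul_s p a b 0 c),
    forall p, pderiv x 0 (fun p => mul_s p a b 0 c) p =
      ((coef a b c).1.2 + 2 * (coef a b c).2 * s0 p) * Q p
  & forall p, pderiv x 1 (fun p => mul_s p a b 0 c) p = h / 2 * mul_s p a b 0 c].
Proof.
have -> : (fun p => mul_s p a b 0 c) =
    quad_exp (coef a b c).1.1 (coef a b c).1.2 (coef a b c).2 (h / 2).
  by apply/funext => p; exact: mul_sE.
have [hol -> ->] := quad_exp_calc l_ge3 (coef a b c).1.1
  (coef a b c).1.2 (coef a b c).2 (h / 2).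
by split=> // p; rewrite ?mul_sE !quad_h; move: (Q p) (s0 p) => q s; ring.
Qed.

Let row2_fun (f : M -> 'rV[Cx R]_2) : f = fun p => row2 (f p 0 0) (f p 0 1).
Proof. by apply/funext => p; apply: row2P; rewrite ?row2_0 ?row2_1. Qed.

Lemma cov_deriv_mul_s a b c p :
  cov_deriv_mul x frob_s (frame a) (frame b) (frame c) p =
  cov_deriv_mul x frob_s (frame b) (frame a) (frame c) p.
Proof.
(* The condition is symmetric in [a] and [b] and trivial when they agree. *)
suff H : cov_deriv_mul x frob_s (frame 0) (frame 1) (frame c) p =
    cov_deriv_mul x frob_s (frame 1) (frame 0) (frame c) p.
  case: (ord2P a) (ord2P b) => -> [] ->;
    [exact: erefl | exact: H | exact: esym H | exact: erefl].
rewrite /cov_deriv_mul !vprod_frame /= !levi_civita_frame_s.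
rewrite (row2_fun (fun p => mul_s p 1 c)) (row2_fun (fun p => mul_s p 0 c)).
rewrite !levi_civita_s /vprod !frob_prod_s.
have [_ d0 _] := mul_s_calc 1 c 0; have [_ d1 _] := mul_s_calc 1 c 1.
have [_ _ d2] := mul_s_calc 0 c 0; have [_ _ d3] := mul_s_calc 0 c 1.
rewrite d0 d1 d2 d3.
apply: row2P; rewrite !mxE;
case: (ord2P c) => ->; rewrite /mul_s /coef /christoffel_s /= ?mxE /= ?quad_h;
rewrite -?/(Q p); move: (Q p) (s0 p) => q s; by field.
Qed.

Lemma unit_flat_s a p : levi_civita x eta_s (frame a) (frob_unit frob_s) p = 0.
Proof.
have [_ d0 d1] := quad_exp_calc l_ge3 1 0 0 (- (h / 2)).
rewrite /= levi_civita_s.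
apply: row2P; rewrite ?row2_0 ?row2_1 [RHS]mxE ?pderiv_cst;
case: (ord2P a) => ->; rewrite ?d0 ?d1 /christoffel_s /quad_exp /=;
move: (exp_s1 _ p) (s0 p) => q s; by field.
Qed.

Let euler_bracket a : bracket x (frob_euler frob_s) (frame a) = fun=> 0.
Proof. exact: bracket_cst. Qed.

Let vapply_euler f p : vapply x (frob_euler frob_s) f p = 2 / h * pderiv x 1 f p.
Proof. by rewrite /vapply sum2 /= row2_0 row2_1 mul0r add0r. Qed.

Lemma metric_homogeneous_s a b p :
  lie_metric x eta_s (frob_euler frob_s) (frame a) (frame b) p =
  (2 - (1 - 2 / h)) * pairing eta_s (frame a) (frame b) p.
Proof.
have pair0 w : pairing eta_s (fun=> 0) w p = 0 by rewrite /pairing !mul0mx mxE.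
have pair0' w : pairing eta_s w (fun=> 0) p = 0.
  by rewrite /pairing trmx0 mulmx0 mxE.
rewrite /lie_metric !euler_bracket vapply_euler pair0 pair0' !subr0 pairing_frame.
rewrite ((eta_s_pderiv a b).2 p).2.
by move: (eta_s p a b) => e; rewrite /k; field.
Qed.

(** The Euler field is $\frac2h\partial_{s^2}$ and every component of the product has exponent
    $\frac h2$ in $s^2$, so the weight is 1. *)
Lemma mul_homogeneous_s a b p :
  lie_mul x frob_s (frame a) (frame b) p = vprod frob_s (frame a) (frame b) p.
Proof.
have prod0 u : frob_prod frob_s p 0 u = 0.
  by rewrite frob_prod_s; apply: row2P; rewrite !mxE; ring.
have prod0' u : frob_prod frob_s p u 0 = 0.
  by rewrite frob_prod_s; apply: row2P; rewrite !mxE; ring.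
rewrite /lie_mul !euler_bracket /vprod prod0 prod0' !subr0.
rewrite -/(vprod frob_s (frame a) (frame b)) vprod_frame.
apply/rowP => c; rewrite mxE vapply_euler.
have [_ _ ->] := mul_s_calc a b c.
rewrite /vapply big1 => [|i _]; last by rewrite pderiv_cst mulr0.
have -> : frob_prod frob_s p (frame a p) (frame b p) = mul_s p a b.
  by rewrite -[LHS]/(vprod frob_s (frame a) (frame b) p) vprod_frame.
by move: (mul_s p a b 0 c) => e; field.
Qed.

Lemma is_frobenius_s : is_frobenius x frob_s (1 - 2 / h).
Proof.
split.
- by move=> a b; exact: (eta_s_pderiv a b).1.
- by move=> a b c; case: (mul_s_calc a b c).
- move=> a; have [hol _ _] := quad_exp_calc l_ge3 1 0 0 (- (h / 2)).
  case: (ord2P a) => ->; rewrite /=.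
    by under eq_fun do rewrite row2_0.
  by under eq_fun do rewrite row2_1; exact: holomorphic_cst.
- by move=> a; exact: holomorphic_cst.
- by move=> p; rewrite /= eta_sE; apply: mx2P; rewrite mxE !mx2E.
- by move=> p; exact: (eta_s_inv p).1.
- move=> p u v; rewrite !frob_prod_s; congr row2; ring.
- move=> p u v w; rewrite !frob_prod_s !row2_0 !row2_1.
  move: (Q p) (s0 p) => q s; congr row2; by field.
- move=> p u; rewrite frob_prod_s /= !row2_0 !row2_1 /quad_exp exp_s1N.
  have := Q0 p; rewrite /Q; move: (exp_s1 (h / 2) p) (s0 p) => q s q0.
  by apply: row2P; rewrite ?row2_0 ?row2_1; field.
- move=> p u v w; rewrite !frob_prod_s /= eta_sE.
  move: (E p) (Q p) (s0 p) => e q s.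
  apply/matrixP => i j; rewrite !ord1 !mxE !sum2 !mxE !sum2 !mxE /=; by field.
- exact: flat_s.
- exact: cov_deriv_mul_s.
- exact: unit_flat_s.
- exact: metric_homogeneous_s.
- exact: mul_homogeneous_s.
Qed.

Lemma flat_coordinates_s : flat_coordinates x frob_s (t_coord l).
Proof.
split; [exact: local_coordinates_t | by rewrite dt0E |].
move=> a i p; case: (ord2P i) => ->; first by rewrite dt0E //; exact: unit_flat_s.
rewrite dt1E // [frob_metric _]/= levi_civita_s.
have [_ d00 d01] := quad_exp_calc l_ge3 0 (- (h / 2)) 0 (- 1).
have [_ d10 d11] := @quad_exp_calc R l l_ge3 1 0 0 (- 1).
apply: row2P; rewrite ?row2_0 ?row2_1 [RHS]mxE;
case: (ord2P a) => ->; rewrite ?d00 ?d01 ?d10 ?d11 /christoffel_s /quad_exp /=;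
move: (exp_s1 _ p) (s0 p) => q s; by field.
Qed.

(** * The intersection form in the frame of s *)

Lemma frob_prod_frame (S : @frobenius_data R 2 M) p u b :
  frob_prod S p u (frame b p) = u 0 0 *: frob_mul S p 0 b + u 0 1 *: frob_mul S p 1 b.
Proof.
by rewrite /frob_prod sum2 !sum2; case: (ord2P b) => ->;
   rewrite !mxE /= !mulr1 !mulr0 !scale0r ?addr0 ?add0r.
Qed.

(** As the Euler field is $\frac2h\partial_{s^2}$, only products with the frame vector of index 1
    enter. Stated for any [S], it serves both existence and uniqueness. *)
Lemma intersection_formE (S : @frobenius_data R 2 M) p (w w' : 'cV[Cx R]_2) :
  frob_euler S p = row2 0 (2 / h) ->
  intersection_form S p w w' = 2 / h * \sum_a \sum_b \sum_c
    w a 0 * invmx (frob_metric S p) a b * frob_mul S p 1 b 0 c * w' c 0.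
Proof.
move=> ES; rewrite /intersection_form [RHS]mulr_sumr; apply: eq_bigr => a _.
rewrite [RHS]mulr_sumr; apply: eq_bigr => b _.
rewrite ES frob_prod_frame row2_0 row2_1 scale0r add0r -scalemxAl mxE [(_ *m _) 0 0]mxE.
rewrite [RHS]mulr_sumr !mulr_sumr; apply: eq_bigr => c _.
by move: (w a 0) (invmx _ _ _) (frob_mul _ _ _ _ _ _) (w' c 0) => u1 u2 u3 u4; ring.
Qed.

Lemma gform_s (f f' : M -> Cx R) (y : Xcover) :
  holomorphic x f -> holomorphic x f' -> let p := Defs.orbit l y in
  gform l y (differential (fun z : Xcover => \val z) (f \o Defs.orbit l) y)
            (differential (fun z : Xcover => \val z) (f' \o Defs.orbit l) y) =
  (h ^+ 2 / 2 * (s0 p ^+ 2 + 4) * (pderiv x 0 f p * pderiv x 0 f' p)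
   - 2 * (pderiv x 1 f p * pderiv x 1 f' p)) / E p.
Proof. by move=> hf hf' p; rewrite gform_orbit // s0E /E exp_s1E mul1r. Qed.

Lemma intersection_form_sE p (w w' : 'cV[Cx R]_2) :
  intersection_form frob_s p w w' =
  (h ^+ 2 / 2 * (s0 p ^+ 2 + 4) * (w 0 0 * w' 0 0) - 2 * (w 1 0 * w' 1 0)) / E p.
Proof.
rewrite intersection_formE // (eta_s_inv p).2 !sum2 !mx2E /mul_s /=.
rewrite !row2_0 !row2_1 !quad_h.
move: (w 0 0) (w 1 0) (w' 0 0) (w' 1 0) => f0 f1 f0' f1'.
move: (E0 p) (Q0 p); rewrite /Q -/(E p) -/(Q p).
move: (E p) (Q p) (s0 p) => e q s e0 q0.
by field; rewrite h0 e0 q0.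
Qed.

Lemma intersection_form_s : intersection_form_is_g frob_s.
Proof.
move=> f f' hf hf' y; rewrite gform_s // intersection_form_sE.
have D g i p : differential x g p i 0 = pderiv x i g p by rewrite mxE.
by congr ((_ * (_ * _) - 2 * (_ * _)) / _); exact: D.
Qed.

(** * Uniqueness *)

Section Uniqueness.
Variable S : @frobenius_data R 2 M.
Local Notation eta := (frob_metric S).
Hypothesis S_frob : is_frobenius x S (1 - 2 / h).
Hypothesis S_flat : flat_coordinates x S (t_coord l).
Hypothesis S_unit : frob_unit S = coord_vfield x (t_coord l) 0.
Hypothesis S_euler : frob_euler S = fun=> row2 0 (2 / h).
Hypothesis S_form : intersection_form_is_g S.

(** Flatness of $\partial_{t^1}=e^{-hs^2/2}\partial_{s^1}$ gives the symbols with middle index 0;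
    flatness of $\partial_{t^2}$ then gives those with middle index 1. *)
Lemma christoffel_unique p a b c :
  christoffel x eta p a b c = christoffel_s (s0 p) a b c.
Proof.
have [_ _ flat] := S_flat.
have [_ d00 d01] := @quad_exp_calc R l l_ge3 0 (- (h / 2)) 0 (- 1).
have [_ d10 d11] := @quad_exp_calc R l l_ge3 1 0 0 (- 1).
have [_ u0 u1] := @quad_exp_calc R l l_ge3 1 0 0 (- (h / 2)).
have row_fun0 (f g : M -> Cx R) : (fun q => row2 (f q) (g q) 0 0) = f.
  by apply/funext => q; rewrite row2_0.
have row_fun1 (f g : M -> Cx R) : (fun q => row2 (f q) (g q) 0 1) = g.
  by apply/funext => q; rewrite row2_1.
have G0 i j : christoffel x eta p i 0 j = christoffel_s (s0 p) i 0 j.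
  have := congr1 (fun v : 'rV__ => v 0 j) (flat i 0 p).
  rewrite dt0E // levi_civita_frame sum2 row2_0 row2_1 mul0r addr0 [RHS]mxE.
  move: (christoffel _ _ _ _ _ _) => G.
  case: (ord2P i) (ord2P j) => -> [] ->; rewrite ?row_fun0 ?row_fun1 ?pderiv_cst;
  rewrite ?u0 ?u1 /christoffel_s /quad_exp /=;
  move: (exp_s1_neq0 (- (h / 2)) p); move: (exp_s1 _ p) (s0 p) => q s q0 GE;
  apply: (mulfI q0); apply/eqP; rewrite -subr_eq0; apply/eqP; rewrite -[RHS]GE; by field.
have G1 i j : christoffel x eta p i 1 j = christoffel_s (s0 p) i 1 j.
  have := congr1 (fun v : 'rV__ => v 0 j) (flat i 1 p).
  rewrite dt1E // levi_civita_frame sum2 row2_0 row2_1 G0 [RHS]mxE.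
  move: (christoffel _ _ _ _ _ _) => G.
  case: (ord2P i) (ord2P j) => -> [] ->; rewrite ?row_fun0 ?row_fun1 ?pderiv_cst;
  rewrite ?d00 ?d01 ?d10 ?d11 /christoffel_s /quad_exp /=;
  move: (exp_s1_neq0 (- 1) p); move: (exp_s1 _ p) (s0 p) => q s q0 GE;
  apply: (mulfI q0); apply/eqP; rewrite -subr_eq0; apply/eqP; rewrite -[RHS]GE; by field.
by case: (ord2P b) => ->.
Qed.

Let eta_sym p a b : eta p a b = eta p b a.
Proof. by rewrite -[in LHS](metric_symmetric S_frob p) mxE. Qed.

(** Lowering the upper index gives symbols of the first kind; those for $(a,b,d)$ and $(a,d,b)$ add
    up to $\partial_a\eta_{bd}$. The symbols of $\eta$ are already known. *)
Lemma metric_compatible p a b d : pderiv x a (fun q => eta q b d) p =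
  \sum_c christoffel_s (s0 p) a b c * eta p c d
  + \sum_c christoffel_s (s0 p) a d c * eta p c b.
Proof.
have lower a' b' d' : \sum_c christoffel x eta p a' b' c * eta p c d' =
    2^-1 * (pderiv x a' (fun q => eta q b' d') p
      + pderiv x b' (fun q => eta q a' d') p - pderiv x d' (fun q => eta q a' b') p).
  pose D e := pderiv x a' (fun q => eta q b' e) p
      + pderiv x b' (fun q => eta q a' e) p - pderiv x e (fun q => eta q a' b') p.
  rewrite -/(D d').
  have inv e : \sum_c invmx (eta p) c e * eta p c d' = (e == d')%:R.
    have := congr1 (fun A : 'M[Cx R]_2 => A d' e) (mulmxV (metric_nondegenerate S_frob p)).
    rewrite !mxE eq_sym => <-; apply: eq_bigr => c _.
    by rewrite eta_sym mulrC.
  transitivity (2^-1 * \sum_e (\sum_c invmx (eta p) c e * eta p c d') * D e).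
    rewrite /christoffel -/(D _).
    under eq_bigr do rewrite -mulrA mulr_suml.
    rewrite -mulr_sumr exchange_big; congr (_ * _); apply: eq_bigr => e _.
    rewrite mulr_suml; apply: eq_bigr => c _; rewrite -/(D e).
    by move: (D e) (invmx _ _ _) (eta _ _ _) => u1 u2 u3; ring.
  congr (_ * _); rewrite sum2 !inv.
  by case: (ord2P d') => ->; rewrite /= !mulr1n !mulr0n mul1r mul0r ?addr0 ?add0r.
under eq_bigr do rewrite -christoffel_unique.
under [X in _ + X]eq_bigr do rewrite -christoffel_unique.
rewrite !lower.
have sym i j : (fun q => eta q i j) = (fun q => eta q j i) by apply/funext.
rewrite (sym d b).
move: (pderiv x a _ _) (pderiv x b _ _) (pderiv x d _ _) => u1 u2 u3.
by field.
Qed.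

Let bracket_euler a : bracket x (frob_euler S) (frame a) = fun=> 0.
Proof. by rewrite S_euler; exact: bracket_cst. Qed.

Lemma metric_euler p a b : 2 / h * pderiv x 1 (fun q => eta q a b) p =
  (1 + 2 / h) * eta p a b.
Proof.
have pair0 w : pairing eta (fun=> 0) w p = 0 by rewrite /pairing !mul0mx mxE.
have pair0' w : pairing eta w (fun=> 0) p = 0.
  by rewrite /pairing trmx0 mulmx0 mxE.
have := metric_homogeneous S_frob a b p.
rewrite /lie_metric !bracket_euler pair0 pair0' !subr0 pairing_frame.
rewrite /vapply sum2 S_euler row2_0 row2_1 mul0r add0r => ->.
by move: (eta p a b) => u; ring.
Qed.

(** Compatibility and homogeneity both express $\partial_{s^2}\eta$ through $\eta$. Equating them
    gives $(1-\frac2h)\eta_{00}=0$ and $(1-\frac2h)(\eta_{11}-hs^1\eta_{01})=0$; non-degeneracy then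
    excludes $\eta_{01}=0$. *)
Lemma metric_components p :
  [/\ eta p 0 0 = 0, eta p 1 1 = h * s0 p * eta p 0 1 & eta p 0 1 != 0].
Proof.
have h2 : 1 - 2 / h != 0.
  apply/eqP => h2; have /eqP := @hh_neq_real R l l_ge3 2 (negbT (pnatr_eq0 R 2)).
  apply; rewrite (rmorph_nat (real_complex R)).
  apply/eqP; rewrite -subr_eq0 -(mulr0 h) -h2; apply/eqP; by field.
have e00 : eta p 0 0 = 0.
  have := metric_euler p 0 0; rewrite metric_compatible !sum2 /christoffel_s /=.
  move: (eta p 0 0) (eta p 1 0) => u v uv; apply: (mulfI h2).
  apply/eqP; rewrite -subr_eq0; move/eqP: uv; rewrite -subr_eq0 => /eqP uv.
  by apply/eqP; rewrite -[RHS]uv; field.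
have e11 : eta p 1 1 = h * s0 p * eta p 0 1.
  have := metric_euler p 1 1; rewrite metric_compatible !sum2 /christoffel_s /=.
  move: (eta p 1 1) (eta p 0 1) (s0 p) => u v s uv; apply: (mulfI h2).
  apply/eqP; rewrite -subr_eq0; move/eqP: uv; rewrite -subr_eq0 => /eqP uv.
  by apply/eqP; rewrite -[RHS]oppr0 -uv; field.
split=> //; apply/eqP => e01; have := metric_nondegenerate S_frob p.
suff -> : eta p = 0 by rewrite unitmxE det0 unitr0.
by apply: mx2P; rewrite [RHS]mxE ?e00 ?e11 ?(eta_sym p 1 0) ?e01 ?mulr0.
Qed.

(** The unit is $e^{-hs^2/2}\partial_{s^1}$, so multiplication by $\partial_{s^1}$ is the scalar
    $e^{hs^2/2}$. *)
Lemma mul_unique_0 p b : frob_mul S p 0 b = mul_s p 0 b.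
Proof.
have := mul_unit S_frob p (frame b p).
rewrite S_unit dt0E // frob_prod_frame row2_0 row2_1 scale0r addr0.
rewrite /quad_exp exp_s1N -/(Q p) !mul0r !addr0 mul1r => /(congr1 (fun v => Q p *: v)).
rewrite scalerA divff ?scale1r // => ->.
rewrite /mul_s /=; case: (ord2P b) => -> /=; rewrite quad_h;
by apply: row2P; rewrite !mxE /=; move: (Q p) (s0 p) => q s; ring.
Qed.

Lemma mul_unique_10 p : frob_mul S p 1 0 = frob_mul S p 0 1.
Proof.
have := mul_commutative S_frob p (frame 1 p) (frame 0 p).
rewrite !frob_prod_frame; have fr (i j : 'I_2) : frame i p 0 j = (j == i)%:R :> Cx R.
  exact: frameE.
by rewrite !fr /= !scale0r !scale1r add0r addr0.
Qed.

(** The equality of the two forms tested on the coordinate functions $s^1,s^2$ themselves, whose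
    differentials are the coframe. *)
Lemma intersection_unique p a c :
  2 / h * \sum_b invmx (eta p) a b * frob_mul S p 1 b 0 c =
  (h ^+ 2 / 2 * (s0 p ^+ 2 + 4) * ((0 == a)%:R * (0 == c)%:R)
   - 2 * ((1 == a)%:R * (1 == c)%:R)) / E p.
Proof.
have x_inj := @s_coord_inj R l l_ge3; have x_open := @s_coord_open R l l_ge3.
have hx i := holomorphic_coord x_inj x_open i.
have [y ->] := orbit_surj p; move: (S_form (hx a) (hx c) y).
rewrite (gform_s y (hx a) (hx c)) !(pderiv_coord x_inj x_open) => <-.
have D j : differential x (fun q => x q 0 j) (Defs.orbit l y) = delta_mx j 0.
  by apply/colP => i; rewrite !mxE pderiv_coord // andbT.
have dE (i j : 'I_2) : delta_mx j 0 i (0 : 'I_1) = (i == j)%:R :> Cx R.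
  by rewrite mxE andbT.
rewrite !D intersection_formE ?S_euler //; congr (_ * _).
rewrite [RHS](bigD1 a) //= [X in _ + X]big1 ?addr0 => [|i /negPf ia].
  apply: eq_bigr => b _; rewrite [RHS](bigD1 c) //= big1 ?addr0 => [|j /negPf jc].
    by rewrite !dE !eqxx mul1r mulr1.
  by rewrite (dE j) jc mulr0.
by apply: big1 => b _; apply: big1 => j _; rewrite (dE i) ia !mul0r.
Qed.

Lemma frobenius_unique : S = frob_s.
Proof.
have [metric_eq mul_eq] : eta = eta_s /\ frob_mul S = mul_s.
  suff H p : eta p = eta_s p /\ frob_mul S p 1 1 = mul_s p 1 1.
    split; apply/funext => p; first exact: (H p).1.
    apply/funext => a; apply/funext => b.
    case: (ord2P a) => ->; first exact: mul_unique_0.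
    case: (ord2P b) => ->; last exact: (H p).2.
    by rewrite mul_unique_10 mul_unique_0.
  have [e00 e11 e01] := metric_components p.
  have form := intersection_unique p.
  have eta_mx : eta p = mx2 0 (eta p 0 1) (eta p 0 1) (h * s0 p * eta p 0 1).
    by apply: mx2P; rewrite !mx2E // eta_sym.
  have [|_ inv] := @mx2_inv _ 0 (eta p 0 1) (eta p 0 1) (h * s0 p * eta p 0 1).
    by rewrite mul0r sub0r oppr_eq0 mulf_neq0.
  rewrite -eta_mx in inv.
  have form00 := form 0 0; have form01 := form 0 1; have form11 := form 1 1.
  move: form00 form01 form11; rewrite inv !sum2 mul_unique_10 mul_unique_0.
  have sc (u : Cx R) (A : 'M[Cx R]_2) i j : (u *: A) i j = u * A i j by rewrite mxE.
  rewrite !sc !mx2E /mul_s /= row2_0 row2_1 quad_h.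
  move: (E0 p) (Q0 p) e01; rewrite -/(Q p) => e0 q0 m0 form00 form01 form11.
  (* The inverse metric has zero entry at (1,1), so this entry of the form involves only the known
     product of the two frame vectors and determines $\eta_{01}$. *)
  have mE : eta p 0 1 = - h^-1 * (E p * Q p).
    move: form11; move: (eta p 0 1) (E p) (Q p) (s0 p) (frob_mul S p 1 1 0 1) m0 e0 q0.
    move=> m e q s B m0 e0 q0 form11; apply/eqP; rewrite -subr_eq0; apply/eqP.
    apply: (mulfI (_ : 2 / (m * e) != 0));
      first by rewrite mulf_neq0 ?invr_neq0 // mulf_neq0.
    move/eqP: form11; rewrite -subr_eq0 => /eqP form11.
    by rewrite mulr0 -[RHS]form11; field; rewrite h0 m0 e0.
  rewrite mE in form00 form01 m0.
  split.
    rewrite eta_mx mE eta_sE; congr mx2.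
    by move: (E p) (Q p) (s0 p) => e q s; field.
  rewrite /mul_s /= !quad_h.
  move: form00 form01 m0; move: (frob_mul S p 1 1) (E p) (Q p) (s0 p) e0 q0 => v e q s e0 q0.
  (* With $\eta$ known, the entries (0,0) and (0,1) of the form are linear equations, each in one
     component of $\partial_{s^2}\circ\partial_{s^2}$. *)
  move=> form00 form01 m0; apply: row2P; rewrite ?row2_0 ?row2_1.
    apply/eqP; rewrite -subr_eq0; apply/eqP.
    move/eqP: form00; rewrite -subr_eq0 => /eqP form00.
    apply: (mulfI (_ : 2 / (e * q) != 0));
      first by rewrite mulf_neq0 ?invr_neq0 // mulf_neq0.
    by rewrite mulr0 -[RHS]oppr0 -[in RHS]form00; field; rewrite h0 e0 q0.
  apply/eqP; rewrite -subr_eq0; apply/eqP.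
  move/eqP: form01; rewrite -subr_eq0 => /eqP form01.
  apply: (mulfI (_ : 2 / (e * q) != 0));
      first by rewrite mulf_neq0 ?invr_neq0 // mulf_neq0.
  by rewrite mulr0 -[RHS]oppr0 -[in RHS]form01; field; rewrite h0 e0 q0.
move: metric_eq mul_eq S_unit S_euler; rewrite dt0E //.
by case: S => /= ? ? ? ? -> -> -> ->.
Qed.

End Uniqueness.

End FrobeniusStructure.

Theorem theorem1p1 (R : realType) (l : nat) (hl : (3 <= l)%N) :
  exists! S : @frobenius_data R 2 (orbit_space R l),
    [/\ is_frobenius (s_coord l) S (1 - 2 / hh R l),
        flat_coordinates (s_coord l) S (t_coord l),
        frob_unit S = coord_vfield (s_coord l) (t_coord l) 0,
        frob_euler S = (fun p =>
          t_coord l p 0 0 *: coord_vfield (s_coord l) (t_coord l) 0 p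
          + (2 / hh R l * t_coord l p 0 1)
              *: coord_vfield (s_coord l) (t_coord l) 1 p)
      & intersection_form_is_g S].
Proof.
rewrite eulerE //; exists (@frob_s R l); split.
  split; [exact: is_frobenius_s | exact: flat_coordinates_s | |
    exact: erefl | exact: intersection_form_s].
  by rewrite dt0E.
by move=> S [S_frob S_flat S_unit S_euler S_form]; apply/esym/frobenius_unique.
Qed.
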